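(* Let $\nabla$ be a linear connection on a differentiable manifold $M$ and let $U\subseteq M$ be a neighborhood (of a point). There exists in $U$ a basis of vector fields in which the components of $\nabla$ vanish on $U$ if and only if $\nabla$ is flat in $U$.
   Context: $\nabla$ is not assumed torsion free and the basis is not assumed to be a coordinate one. In a local basis (frame) $\{E_i\}$ the components of $\nabla$ are the functions $\Gamma^i_{.jk}$ with $\nabla_X(E_j)=\Gamma^i_{.jk}X^kE_i$ for $X=X^kE_k$ (summation over repeated indices). $\nabla$ is flat in $U$ if its curvature $R^\nabla(X,Y)=\nabla_X\nabla_Y-\nabla_Y\nabla_X-\nabla_{[X,Y]}$ vanishes on $U$. The setting is local: a neighborhood $U$ means a coordinate neighborhood of a point, small enough to be identified with an open ball in $\mathbb{R}^n$, $n=\dim M$; all objects are assumed differentiable as many times as the expressions require (e.g. smooth). *)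

(* Defs.v *)
From HB Require Import structures.
From mathcomp Require Import all_boot all_order all_algebra.
From mathcomp Require Import all_classical all_reals all_analysis.
Set Implicit Arguments.
Unset Strict Implicit.
Unset Printing Implicit Defensive.
Import Order.TTheory GRing.Theory Num.Theory.
Import numFieldNormedType.Exports.
Local Open Scope classical_set_scope.
Local Open Scope ring_scope.

(* The library's [ball] on ['rV[R]_n] is the one of the sup norm, a cube. *)
Definition euclidean_ball (R : realType) (n : nat) (c : 'rV[R]_n) (r : R) :
    set 'rV[R]_n :=
  [set x | Num.sqrt (\sum_(i < n) (x ord0 i - c ord0 i) ^+ 2) < r].

(* Below, [U] is meant to be an open subset of R^n. Functions and vector fields
   on [U] are represented by total functions of which only the values on [U]
   matter; a vector field is given by its components in the canonical
   coordinates of R^n. *)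

Fixpoint Ck_on (R : realType) (n : nat) (W : normedModType R) (k : nat)
    (U : set 'rV[R]_n) (f : 'rV[R]_n -> W) : Prop :=
  if k is k'.+1 then
    (forall x, U x -> differentiable f x) /\
    (forall v : 'rV[R]_n, Ck_on k' U (fun x => 'D_v f x))
  else forall x, U x -> {for x, continuous f}.

Definition smooth_on (R : realType) (n : nat) (W : normedModType R)
    (U : set 'rV[R]_n) (f : 'rV[R]_n -> W) : Prop :=
  forall k, Ck_on k U f.

Section Connections.
Variables (R : realType) (n : nat) (U : set 'rV[R]_n).

Definition vector_field (X : 'rV[R]_n -> 'rV[R]_n) : Prop := smooth_on U X.

Definition lie_bracket (X Y : 'rV[R]_n -> 'rV[R]_n) : 'rV[R]_n -> 'rV[R]_n :=
  fun x => 'D_(X x) Y x - 'D_(Y x) X x.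

(* [D X Y] stands for nabla_X Y. Linearity of [D X] over the constants is the
   Leibniz rule for a constant function. *)
Record linear_connection
    (D : ('rV[R]_n -> 'rV[R]_n) -> ('rV[R]_n -> 'rV[R]_n) ->
         'rV[R]_n -> 'rV[R]_n) : Prop := LinearConnection {
  connection_vector_field : forall X Y,
    vector_field X -> vector_field Y -> vector_field (D X Y);
  (* [D] is well defined on vector fields on [U] *)
  connection_ext : forall X X' Y Y',
    vector_field X -> vector_field X' -> vector_field Y -> vector_field Y' ->
    {in U, X =1 X'} -> {in U, Y =1 Y'} -> {in U, D X Y =1 D X' Y'};
  connectionDl : forall X X' Y,
    vector_field X -> vector_field X' -> vector_field Y ->
    forall x, U x -> D (fun y => X y + X' y) Y x = D X Y x + D X' Y x;
  connectionZl : forall (f : 'rV[R]_n -> R) X Y,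
    smooth_on U f -> vector_field X -> vector_field Y ->
    forall x, U x -> D (fun y => f y *: X y) Y x = f x *: D X Y x;
  connectionDr : forall X Y Y',
    vector_field X -> vector_field Y -> vector_field Y' ->
    forall x, U x -> D X (fun y => Y y + Y' y) x = D X Y x + D X Y' x;
  connection_leibniz : forall (f : 'rV[R]_n -> R) X Y,
    smooth_on U f -> vector_field X -> vector_field Y ->
    forall x, U x ->
      D X (fun y => f y *: Y y) x = 'D_(X x) f x *: Y x + f x *: D X Y x
}.

Definition curvature
    (D : ('rV[R]_n -> 'rV[R]_n) -> ('rV[R]_n -> 'rV[R]_n) ->
         'rV[R]_n -> 'rV[R]_n)
    (X Y Z : 'rV[R]_n -> 'rV[R]_n) : 'rV[R]_n -> 'rV[R]_n :=
  fun x => D X (D Y Z) x - D Y (D X Z) x - D (lie_bracket X Y) Z x.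

Definition flat
    (D : ('rV[R]_n -> 'rV[R]_n) -> ('rV[R]_n -> 'rV[R]_n) ->
         'rV[R]_n -> 'rV[R]_n) : Prop :=
  forall X Y Z, vector_field X -> vector_field Y -> vector_field Z ->
  forall x, U x -> curvature D X Y Z x = 0.

Definition frame (E : 'I_n -> 'rV[R]_n -> 'rV[R]_n) : Prop :=
  (forall i, vector_field (E i)) /\
  (forall x, U x -> basis_of {:'rV[R]_n} [tuple E i x | i < n]).

(* [Gamma i j k] is Gamma^i_{.jk}: the last lower index is the one contracted
   with the direction of differentiation, and the components [a] of [X] are
   taken in the same frame [E]. *)
Definition connection_components
    (D : ('rV[R]_n -> 'rV[R]_n) -> ('rV[R]_n -> 'rV[R]_n) ->
         'rV[R]_n -> 'rV[R]_n)
    (E : 'I_n -> 'rV[R]_n -> 'rV[R]_n)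
    (Gamma : 'I_n -> 'I_n -> 'I_n -> 'rV[R]_n -> R) : Prop :=
  forall (X : 'rV[R]_n -> 'rV[R]_n) (a : 'I_n -> 'rV[R]_n -> R),
  vector_field X ->
  (forall x, U x -> X x = \sum_(k < n) a k x *: E k x) ->
  forall (j : 'I_n) x, U x ->
    D X (E j) x = \sum_(i < n) \sum_(k < n) (Gamma i j k x * a k x) *: E i x.

End Connections.

(* Main.v *)
Require Import Defs.
From HB Require Import structures.
From mathcomp Require Import all_boot all_order all_algebra.
From mathcomp Require Import all_classical all_reals all_analysis.
From mathcomp Require Import ring lra.
Import Order.TTheory GRing.Theory Num.Theory.
Import numFieldNormedType.Exports.
Set Implicit Arguments.
Unset Strict Implicit.
Unset Printing Implicit Defensive.
Local Open Scope classical_set_scope.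
Local Open Scope ring_scope.

(** In the canonical frame of the ball a connection is a matrix-valued one-form
[A], and covariant differentiation of a row [Z] is [dZ + Z A] ([connectionE]).
Parallel fields are the solutions of the overdetermined linear system
[dP = - P A], and flatness is its integrability condition.

If a parallel frame exists, its fields are annihilated by the curvature, which
is a tensor: [R(X, Y) Z = Z Omega(X, Y)] with [Omega] the curvature form
([curvatureE], which rests on the symmetry of second derivatives [derive_sym]).
As the frame is a basis at every point, [Omega] vanishes
([flat_of_parallel_frame]).

Conversely let the connection be flat. For a row [s0], let [P x] be the parallel
transport of [s0] along the straight ray from the centre [c] to [x]: the value at
time [1] of the solution of a linear ordinary differential equation
([linear_ode_solution], [ray_transport]). The heart of the proof is that [P]
solves the system. Instead of differentiating the solutions of the equation with
respect to parameters, one compares the transport [u] towards [x] with the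
transport [w] towards [x + h] through the defect [g = w - u + t u A(h)]. Flatness
turns the derivative of [g] into a multiple of [g] plus a remainder of second
order in [h], so Gronwall's inequality gives
[P (x + h) - P x + P x A(h) = O(h^2)] ([transport_expansion]), which says at once
that [P] is differentiable at [x] and what its derivative is. Smoothness of [P]
then follows from the equation itself ([parallel_smooth]). The parallel fields
that extend the canonical basis at [c] remain independent at every [x], because
a parallel field which vanishes at [x] vanishes on the whole ray down to [c]
([parallel_vanish]). *)

(** * Norms and derivatives of matrix-valued functions *)

Lemma mx_entry_norm_le (R : realType) (m n : nat) (A : 'M[R]_(m, n)) i j :
  `|A i j| <= `|A|.
Proof.
rewrite [leRHS]/Num.Def.normr/= mx_normrE.
by apply: (@le_trans _ _ `|A (i, j).1 (i, j).2|) => //; apply: le_bigmax.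
Qed.

Lemma mx_norm_le (R : realType) (m n : nat) (A : 'M[R]_(m, n)) (e : R) :
  0 <= e -> (forall i j, `|A i j| <= e) -> `|A| <= e.
Proof.
move=> e0 Ae; rewrite [leLHS]/Num.Def.normr/= mx_normrE.
by apply: bigmax_le => // -[i j] _; apply: Ae.
Qed.

Lemma mulmx_norm_le (R : realType) (m n p : nat)
    (A : 'M[R]_(m, n)) (B : 'M[R]_(n, p)) :
  `|A *m B| <= n%:R * (`|A| * `|B|).
Proof.
apply: mx_norm_le => [|i j]; first by rewrite !mulr_ge0.
rewrite mxE; apply: le_trans (ler_norm_sum _ _ _) _.
apply: (@le_trans _ _ (\sum_(k < n) `|A| * `|B|)).
  by apply: ler_sum => k _; rewrite normrM ler_pM// mx_entry_norm_le.
by rewrite sumr_const card_ord mulr_natl.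
Qed.

Lemma row_comb_norm_le (R : realType) (m n p : nat) (v : 'rV[R]_n)
    (F : 'I_n -> 'M[R]_(m, p)) (B : R) :
  (forall k, `|F k| <= B) -> `|\sum_(k < n) v 0 k *: F k| <= n%:R * (`|v| * B).
Proof.
move=> FB; apply: le_trans (ler_norm_sum _ _ _) _.
apply: (@le_trans _ _ (\sum_(k < n) `|v| * B)).
  by apply: ler_sum => k _; rewrite normrZ ler_pM// mx_entry_norm_le.
by rewrite sumr_const card_ord -[leLHS]mulr_natl.
Qed.

Section PointwiseDerivative.
Variables (R : realType) (V : normedModType R) (x v : V).

(** [is_deriveD] and its relatives speak of sums and products of functions,
which do not match functions given by a body; the rules of this section do. *)
Lemma is_derive_congr (W : normedModType R) (f g : V -> W) df dg :
  is_derive x v f df -> f =1 g -> df = dg -> is_derive x v g dg.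
Proof. by move=> + /funext <- <-. Qed.

Lemma is_derive_addx (W : normedModType R) (f g : V -> W) df dg :
  is_derive x v f df -> is_derive x v g dg ->
  is_derive x v (fun y => f y + g y) (df + dg).
Proof. exact: is_deriveD. Qed.

Lemma is_derive_oppx (W : normedModType R) (f : V -> W) df :
  is_derive x v f df -> is_derive x v (fun y => - f y) (- df).
Proof. exact: is_deriveN. Qed.

Lemma is_derive_subx (W : normedModType R) (f g : V -> W) df dg :
  is_derive x v f df -> is_derive x v g dg ->
  is_derive x v (fun y => f y - g y) (df - dg).
Proof. exact: is_deriveB. Qed.

Lemma is_derive_mulx (f g : V -> R) df dg :
  is_derive x v f df -> is_derive x v g dg ->
  is_derive x v (fun y => f y * g y) (df * g x + f x * dg).
Proof.
move=> fx gx; apply: is_derive_congr (is_deriveM fx gx) _ _ => //.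
by rewrite /GRing.scale/=; ring.
Qed.

Lemma is_derive_sumx (W : normedModType R) (n : nat) (f : 'I_n -> V -> W) df :
  (forall i, is_derive x v (f i) (df i)) ->
  is_derive x v (fun y => \sum_(i < n) f i y) (\sum_(i < n) df i).
Proof.
move=> fx; apply: is_derive_congr (is_derive_sum fx) _ _ => // y.
by rewrite fct_sumE.
Qed.

Lemma is_derive_mxP (m n : nat) (M : V -> 'M[R]_(m, n)) dM :
  is_derive x v M dM <->
  forall i j, is_derive x v (fun y => M y i j) (dM i j).
Proof.
split=> [[Mx <-] i j|Mx].
  have Mij := (derivable_mxP M x v).1 Mx.
  by apply: DeriveDef => //; rewrite derive_mx// mxE.
have Mxv : derivable M x v by apply/derivable_mxP => i j.
apply: DeriveDef => //; rewrite derive_mx//; apply/matrixP => i j.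
by rewrite mxE derive_val.
Qed.

Lemma is_derive_mulmx (m n p : nat) (M : V -> 'M[R]_(m, n))
    (N : V -> 'M[R]_(n, p)) dM dN :
  is_derive x v M dM -> is_derive x v N dN ->
  is_derive x v (fun y => M y *m N y) (dM *m N x + M x *m dN).
Proof.
move=> /is_derive_mxP Mx /is_derive_mxP Nx; apply/is_derive_mxP => i j.
have := is_derive_sumx (fun k => is_derive_mulx (Mx i k) (Nx k j)).
move=> /is_derive_congr; apply => [y|]; first by rewrite mxE.
by rewrite !mxE big_split.
Qed.

Lemma is_derive_scalemx (m n : nat) (f : V -> R) (M : V -> 'M[R]_(m, n))
    df dM :
  is_derive x v f df -> is_derive x v M dM ->
  is_derive x v (fun y => f y *: M y) (df *: M x + f x *: dM).
Proof.
move=> fx /is_derive_mxP Mx; apply/is_derive_mxP => i j.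
apply: is_derive_congr (is_derive_mulx fx (Mx i j)) _ _ => [y|];
  by rewrite !mxE.
Qed.

End PointwiseDerivative.

(** The difference quotients of the restriction of [f] to a line are literally
the difference quotients of [f] in the direction of that line. *)
Lemma is_derive_line (R : realType) (V W : normedModType R) (f : V -> W)
    (x v : V) (t : R) df :
  is_derive (x + t *: v) v f df ->
  is_derive t 1 (fun s => f (x + s *: v)) df.
Proof.
set y := x + t *: v => -[fy <-].
have E : (fun h : R => h^-1 *: (f (x + (h%:A + t) *: v) - f (x + t *: v))) =
         (fun h : R => h^-1 *: (f (h *: v + y) - f y)).
  apply/funext => h; congr (_ *: (f _ - _)).
  by rewrite /y addrCA -scalerDl [h%:A]mulr1.
by apply: DeriveDef; [rewrite /derivable/= E|rewrite /derive/= E].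
Qed.

Lemma is_derive_rev (R : realType) (W : normedModType R) (f : R -> W)
    (a t : R) df :
  is_derive (a - t) 1 f df -> is_derive t 1 (fun s => f (a - s)) (- df).
Proof.
move=> [f1 <-].
have fa : differentiable f (a - t) by apply/derivable1_diffP.
have := @is_derive_line R R W f a (-1) t (- 'D_1 f (a - t)).
rewrite /GRing.scale/= mulrN1 => H.
have : is_derive (a - t) (-1) f (- 'D_1 f (a - t)).
  apply: DeriveDef; first exact: diff_derivable.
  by rewrite !deriveE// linearN.
by move=> /H/is_derive_congr; apply => // s; rewrite mulrN1.
Qed.

(** * Gronwall's inequality *)

Section Gronwall.
Variables (R : realType) (n : nat).

(** The norm on rows is the sup norm, which is not differentiable; energy
estimates use the sum of squares and come back to the norm here. *)
Lemma mx_norm_sqr_le_sum (u : 'rV[R]_n) :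
  `|u| ^+ 2 <= \sum_(i < n) u 0 i ^+ 2.
Proof.
have s0 : 0 <= \sum_(i < n) u 0 i ^+ 2 by apply: sumr_ge0 => i _; rewrite sqr_ge0.
rewrite -(sqr_sqrtr s0) lerXn2r ?nnegrE ?sqrtr_ge0//.
apply: mx_norm_le => [|i j]; first exact: sqrtr_ge0.
rewrite (ord1 i) -sqrtr_sqr ler_wsqrtr// (bigD1 j)//= lerDl.
by apply: sumr_ge0 => k _; rewrite sqr_ge0.
Qed.

(** Let [phi] be the sum of the squares of the coordinates of [u]. The hypothesis
gives [phi' <= C * (phi + e ^+ 2)] with [C = n%:R * (2 * L + 1)], so that
[(phi + e ^+ 2) * expR (- C * t)] decreases. The exponent is not sharp; what
matters is that the bound is proportional to [e]. *)
Lemma gronwall (u du : R -> 'rV[R]_n) (L e : R) : 0 <= L -> 0 <= e ->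
  u 0 = 0 ->
  (forall t : R, 0 <= t <= 1 -> is_derive t 1 u (du t)) ->
  (forall t : R, 0 <= t <= 1 -> `|du t| <= L * `|u t| + e) ->
  `|u 1| <= e * expR (n%:R * (2 * L + 1)).
Proof.
move=> L0 e0 u00 uE duE.
set C := n%:R * (2 * L + 1).
have C0 : 0 <= C by rewrite mulr_ge0// addr_ge0// mulr_ge0.
pose phi (t : R) := \sum_(i < n) u t 0 i * u t 0 i.
pose dphi (t : R) := \sum_(i < n) (du t 0 i * u t 0 i + u t 0 i * du t 0 i).
pose psi t := (phi t + e ^+ 2) * expR (- C * t).
pose dpsi t := dphi t * expR (- C * t) - C * psi t.
have dpsiE (t : R) : 0 <= t <= 1 -> is_derive t 1 psi (dpsi t).
  move=> /uE/is_derive_mxP ut.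
  have phiE : is_derive t 1 phi (dphi t).
    by apply: is_derive_sumx => i; exact: is_derive_mulx.
  have expE : is_derive t 1 (fun s => expR (- C * s)) (expR (- C * t) * - C).
    have lin : is_derive t 1 (fun s : R => - C * s) (- C).
      have := is_deriveZ (- C) (is_derive_id t (1 : R)).
      by rewrite /GRing.scale/= mulr1.
    exact: is_derive1_comp.
  have phi_eE := is_derive_addx phiE (is_derive_cst (e ^+ 2) t (1 : R)).
  apply: is_derive_congr (is_derive_mulx phi_eE expE) _ _ => //.
  by rewrite /dpsi /psi addr0 /cst/=; ring.
have phi_ge (t : R) : `|u t| ^+ 2 <= phi t by exact: mx_norm_sqr_le_sum.
have dphi_le (t : R) : 0 <= t <= 1 -> dphi t <= C * (phi t + e ^+ 2).
  move=> /duE dut.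
  pose q := (2 * L + 1) * (`|u t| ^+ 2 + e ^+ 2).
  apply: (@le_trans _ _ (\sum_(i < n) q)); last first.
    rewrite sumr_const card_ord -[leLHS]mulr_natl /q mulrA ler_wpM2l//.
    by rewrite lerD2r.
  apply: ler_sum => i _; rewrite [X in _ + X]mulrC /q.
  have : du t 0 i * u t 0 i <= (L * `|u t| + e) * `|u t|.
    apply: le_trans (ler_norm _) _; rewrite normrM ler_pM// ?mx_entry_norm_le//.
    exact: le_trans (mx_entry_norm_le _ _ _) dut.
  set p := du t 0 i * _; set w := `|u t| => pw.
  have : 0 <= (w - e) ^+ 2 by exact: sqr_ge0.
  have : 0 <= L * e ^+ 2 by rewrite mulr_ge0// sqr_ge0.
  move: pw; rewrite !expr2; nra.
have dpsi0 (t : R) : 0 <= t <= 1 -> dpsi t <= 0.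
  move=> /dphi_le dt; rewrite /dpsi /psi mulrA -mulrBl.
  by rewrite pmulr_lle0 ?expR_gt0// subr_le0.
have psi10 : psi 1 <= psi 0.
  apply: (@ler0_derive1_nincr _ psi 0 1) => //.
  - move=> t; rewrite in_itv/= => /andP[t0 t1].
    have [] := dpsiE t; first by rewrite !ltW.
    by [].
  - move=> t; rewrite in_itv/= => /andP[t0 t1].
    have t01 : 0 <= t <= 1 by rewrite !ltW.
    by rewrite derive1E (@derive_val _ _ _ _ _ _ _ (dpsiE t t01)) dpsi0.
  - apply: derivable_within_continuous => t; rewrite in_itv/= => /dpsiE[].
    by [].
have phi0 : phi 0 = 0.
  by rewrite /phi u00 big1// => i _; rewrite mxE mul0r.
have expC : 1 <= expR C by rewrite -expR0 ler_expR.
have : phi 1 + e ^+ 2 <= e ^+ 2 * expR C.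
  move: psi10; rewrite /psi phi0 add0r mulr0 expR0 !mulr1.
  by rewrite expRN ler_pdivrMr ?expR_gt0.
have := phi_ge 1; move: (phi 1) => p up pe.
rewrite -(@ler_pXn2r _ 2) ?nnegrE ?mulr_ge0 ?expR_ge0// exprMn.
have e2 : 0 <= e ^+ 2 by exact: sqr_ge0.
have : e ^+ 2 * expR C <= e ^+ 2 * expR C ^+ 2.
  by rewrite ler_wpM2l// expr2 ler_peMl ?expR_ge0.
lra.
Qed.

(** The reversed curve [t |-> u (1 - t)] solves the equation with the opposite
coefficient, and [gronwall] applies to it with [e = 0]. *)
Lemma linear_ode_backward_uniqueness (u : R -> 'rV[R]_n) (B : R -> 'M[R]_n)
    (L : R) : 0 <= L ->
  (forall t : R, 0 <= t <= 1 -> is_derive t 1 u (u t *m B t)) ->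
  (forall t : R, 0 <= t <= 1 -> `|B t| <= L) ->
  u 1 = 0 -> u 0 = 0.
Proof.
move=> L0 uE BL u10.
have t01 (t : R) : 0 <= t <= 1 -> 0 <= 1 - t <= 1.
  by move=> /andP[t0 t1]; rewrite subr_ge0 t1 gerBl.
have := @gronwall (fun t => u (1 - t)) (fun t => - (u (1 - t) *m B (1 - t)))
  (n%:R * L) 0.
rewrite mul0r subr0 subrr => H.
have /H{}H : 0 <= n%:R * L by rewrite mulr_ge0.
apply/eqP; rewrite -normr_le0; apply: H => // t /t01 t1.
  by apply: is_derive_rev; exact: uE.
rewrite addr0 normrN (le_trans (mulmx_norm_le _ _))// -mulrA ler_wpM2l//.
by rewrite mulrC ler_wpM2r// BL.
Qed.

End Gronwall.

(** * Linear differential equations *)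

Lemma is_derive_continuous (R : realType) (W : normedModType R) (f : R -> W)
  (t : R) df : is_derive t 1 f df -> {for t, continuous f}.
Proof.
by move=> [fx _]; apply/differentiable_continuous/derivable1_diffP.
Qed.

(** The integral from a base point [a] has the right derivative only at points
greater than [a]; the base point therefore moves with [t] to cover the line. *)
Lemma antiderivative (R : realType) (f : R -> R) : continuous f ->
  exists F : R -> R, F 0 = 0 /\ forall t : R, is_derive t 1 F (f t).
Proof.
move=> cf; pose mu := @lebesgue_measure R.
have fi (a b : R) : mu.-integrable `[a, b] (EFin \o f).
  apply: continuous_compact_integrable; first exact: segment_compact.
  exact: continuous_subspaceT.
pose I (a t : R) := (\int[mu]_(s in `[a, t]) f s)%R.
have IE (a t : R) : a < t -> is_derive t 1 (I a) (f t).
  move=> at1; have tt1 : t < t + 1 by rewrite ltrDl.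
  have [d1 d2] := @continuous_FTC1_closed R f a t _ tt1 (fi _ _) at1 (cf t).
  by apply: DeriveDef; [exact: d1|rewrite -derive1E].
pose F t := I (- `|t| - 1) t - I (- `|t| - 1) 0.
have chasles (a b t : R) : a <= b -> b <= t -> I a t = I a b + I b t.
  move=> ab bt; have := @Rintegral_itvB R f (BLeft a) (BRight t) b (fi a t).
  rewrite !bnd_simp => /(_ ab bt) /eqP; rewrite subr_eq addrC /I /mu => /eqP ->.
  congr (_ + _); rewrite Rintegral_itv_obnd_cbnd//.
  by apply: integrableS (fi b t) => //; apply: subset_itvr; rewrite bnd_simp.
(* The differences of values of [I a] do not depend on the base point [a]. *)
have FE (a t : R) : a < t -> a < 0 -> F t = I a t - I a 0.
  move=> at0 a0; rewrite /F; set b : R := - `|t| - 1.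
  have bt : b <= t by rewrite /b; have := ler_norm (- t); rewrite normrN; lra.
  have b0 : b <= 0 by rewrite /b; have := normr_ge0 t; lra.
  have [ab|/ltW ba] := leP a b.
    rewrite (chasles a b t ab bt) (chasles a b 0 ab b0); ring.
  rewrite (chasles b a t ba (ltW at0)) (chasles b a 0 ba (ltW a0)); ring.
exists F; split; first by rewrite /F subrr.
move=> t; pose a : R := - `|t| - 1.
have at0 : a < t by rewrite /a; have := ler_norm (- t); rewrite normrN; lra.
have a0 : a < 0 by rewrite /a; have := normr_ge0 t; lra.
apply: near_eq_is_derive; last first.
  have := is_derive_subx (IE _ _ at0) (is_derive_cst (I a 0) t (1 : R)).
  by rewrite subr0; apply.
near=> s; rewrite /cst/= (FE a)//; near: s; exact: lt_nbhsr.
Unshelve. all: by end_near. Qed.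

Lemma exists_div_pow2_lt (R : realType) (a e : R) :
  0 < e -> exists m, a / 2 ^+ m < e.
Proof.
move=> e0; have half : `|2^-1 : R| < 1 by rewrite ger0_norm; lra.
have := cvg_geometric a half => /cvgrPdist_lt/(_ e e0)[m _ /(_ m)].
rewrite /= leqnn => /(_ isT); rewrite sub0r normrN exprVn => am.
by exists m; exact: le_lt_trans (ler_norm _) am.
Qed.

Lemma continuous_mx (R : realType) (T : topologicalType) (m n : nat)
    (M : T -> 'M[R]_(m, n)) (x : T) :
  (forall i j, {for x, continuous (fun y => M y i j)}) -> {for x, continuous M}.
Proof.
move=> Mx; apply/cvgrPdist_le => e e0; near=> y.
apply: mx_norm_le => [|i j]; first exact: ltW.
rewrite !mxE; move: i j; near: y.
apply: filter_forall => i; apply: filter_forall => j.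
exact: (cvgrPdist_le _ _).1 (Mx i j) _ e0.
Unshelve. all: by end_near. Qed.

Lemma continuous_sumx (R : realType) (T : topologicalType) (m : nat)
    (f : 'I_m -> T -> R) (x : T) :
  (forall i, {for x, continuous (f i)}) ->
  {for x, continuous (fun y => \sum_(i < m) f i y)}.
Proof.
move=> cf; apply: cvg_big => [|i _]; [exact: add_continuous|exact: cf].
Qed.

Lemma continuous_mulmx (R : realType) (T : topologicalType) (m n p : nat)
    (M : T -> 'M[R]_(m, n)) (N : T -> 'M[R]_(n, p)) (x : T) :
  {for x, continuous M} -> {for x, continuous N} ->
  {for x, continuous (fun y => M y *m N y)}.
Proof.
move=> Mx Nx; apply: continuous_mx => i j.
rewrite (_ : (fun y => _) = fun y => \sum_(k < n) M y i k * N y k j); last first.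
  by apply/funext => y; rewrite mxE.
have coord q r (P : T -> 'M[R]_(q, r)) a b : {for x, continuous P} ->
    {for x, continuous (fun y => P y a b)}.
  move=> Px; apply: (@continuous_comp _ _ _ P (fun Q => Q a b)) => //.
  exact: coord_continuous.
apply: continuous_sumx => k.
by apply: cvgM; apply: coord.
Qed.

Lemma telescoping_limit (R : realType) (p q : nat)
    (s : nat -> 'M[R]_(p, q)) (a : R) :
  (forall m, `|s m.+1 - s m| <= a / 2 ^+ m) ->
  exists l, forall m, `|l - s m| <= 2 * a / 2 ^+ m.
Proof.
move=> sa.
have a0 : 0 <= a by have := le_trans (normr_ge0 _) (sa 0%N); rewrite expr0 divr1.
have tail m k : `|s (m + k)%N - s m| <= 2 * a / 2 ^+ m - 2 * a / 2 ^+ (m + k).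
  elim: k => [|k IH]; first by rewrite addn0 !subrr normr0.
  rewrite addnS -(subrKA (s (m + k)%N)).
  apply: le_trans (ler_normD _ _) _.
  have := lerD (sa (m + k)%N) IH; rewrite exprS.
  set d := 2 ^+ (m + k); have d0 : d != 0 by rewrite expf_neq0.
  have -> : 2 * a / (2 * d) = a / d by field.
  have -> : 2 * a / d = a / d + a / d by field.
  lra.
have sc : cvgn s.
  apply/cauchy_cvgP/cauchy_exP => e /(exists_div_pow2_lt (2 * a))[m me]; exists (s m).
  exists m => // k /= mk; rewrite -ball_normE/= distrC -(subnKC mk).
  apply: le_lt_trans (tail m _) _; apply: le_lt_trans _ me.
  by rewrite gerBl divr_ge0 ?mulr_ge0 ?exprn_ge0.
exists (limn s) => m; rewrite distrC.
have dc : (fun k => `|s m - s k|) @ \oo --> `|s m - limn s|.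
  by apply: cvg_norm; apply: cvgB => //; exact: cvg_cst.
rewrite -(cvg_lim _ dc)//; apply: limr_le; first by apply/cvg_ex; exists `|s m - limn s|.
exists m => // k /= mk; rewrite distrC -(subnKC mk).
by apply: le_trans (tail m _) _; rewrite gerBl divr_ge0 ?mulr_ge0 ?exprn_ge0.
Qed.

Lemma antiderivative_row (R : realType) (n : nat) (f : R -> 'rV[R]_n) :
  continuous f ->
  exists F : R -> 'rV[R]_n, F 0 = 0 /\ forall t : R, is_derive t 1 F (f t).
Proof.
move=> cf.
have /choice[F FE] : forall j : 'I_n, exists F : R -> R,
    F 0 = 0 /\ forall t : R, is_derive t 1 F (f t 0 j).
  move=> j; apply: antiderivative => t.
  apply: (@continuous_comp _ _ _ f (fun M : 'rV[R]_n => M 0 j) t).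
    exact: cf.
  exact: coord_continuous.
exists (fun t => \row_j F j t); split.
  by apply/rowP => j; rewrite !mxE; have [] := FE j.
move=> t; apply/is_derive_mxP => i j; have [_ /(_ t) Ft] := FE j.
by apply: is_derive_congr Ft _ _ => [s|]; rewrite ?(ord1 i) ?mxE.
Qed.

(** Both [G - F] and [G + F] are nondecreasing and vanish at [0]. The absolute
value of [G t] accounts for the negative [t], where [G] is negative. *)
Lemma derive_dominated (R : realType) (F G f g : R -> R) :
  F 0 = 0 -> G 0 = 0 ->
  (forall t : R, is_derive t 1 F (f t)) ->
  (forall t : R, is_derive t 1 G (g t)) ->
  (forall t, `|f t| <= g t) -> forall t, `|F t| <= `|G t|.
Proof.
move=> F0 G0 FE GE fg t.
have mono (H h : R -> R) : (forall t : R, is_derive t 1 H (h t)) ->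
    (forall t, 0 <= h t) -> forall a b, a <= b -> H a <= H b.
  move=> HE h0 a b ab; apply: (@ger0_derive1_ndecr _ H a b) => //.
  - by move=> s _; rewrite derive1E (@derive_val _ _ _ _ _ _ _ (HE s)).
  - by apply: continuous_subspaceT => s; apply: is_derive_continuous (HE s).
have m1 := mono _ _ (fun t => is_derive_subx (GE t) (FE t)).
have m2 := mono _ _ (fun t => is_derive_addx (GE t) (FE t)).
have fg1 s : 0 <= g s - f s.
  by rewrite subr_ge0; apply: le_trans (fg s); exact: ler_norm.
have fg2 s : 0 <= g s + f s.
  by have := fg s; have := ler_norm (- f s); rewrite normrN; lra.
have {}m1 := m1 fg1; have {}m2 := m2 fg2.
have [t0|/ltW t0] := leP 0 t.
  have := m1 _ _ t0; have := m2 _ _ t0; rewrite F0 G0 => a1 a2.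
  by rewrite ler_norml (@ger0_norm _ (G t)); lra.
have := m1 _ _ t0; have := m2 _ _ t0; rewrite F0 G0 => a1 a2.
by rewrite ler_norml (@ler0_norm _ (G t)); lra.
Qed.

Lemma derive_dominated_row (R : realType) (n : nat) (F f : R -> 'rV[R]_n)
    (G g : R -> R) :
  F 0 = 0 -> G 0 = 0 ->
  (forall t : R, is_derive t 1 F (f t)) ->
  (forall t : R, is_derive t 1 G (g t)) ->
  (forall t, `|f t| <= g t) -> forall t, `|F t| <= `|G t|.
Proof.
move=> F0 G0 FE GE fg t; apply: mx_norm_le => // i j.
apply: (@derive_dominated _ (fun t => F t i j) G (fun t => f t i j) g) => //.
- by rewrite F0 mxE.
- by move=> s; have /is_derive_mxP := FE s; apply.
- by move=> s; apply: le_trans (mx_entry_norm_le _ _ _) (fg s).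
Qed.

Section LinearODE.
Variables (R : realType) (n : nat) (B : R -> 'M[R]_n) (L : R).
Hypotheses (cB : continuous B) (BL : forall t, `|B t| <= L).

Let k := 2 * n%:R * L + 1.

Let L0 : 0 <= L. Proof. exact: le_trans (BL 0). Qed.

Let k0 : 0 < k. Proof. by rewrite ltr_wpDl// !mulr_ge0. Qed.

(* An exponential weight, even in [t] so that both time directions are treated
   alike. Its primitive [W] gains a factor [k^-1], and [k] is chosen such that
   this gain halves the bound at each Picard step. *)
Let w (t : R) := expR (k * t) + expR (- k * t).
Let W (t : R) := k^-1 * (expR (k * t) - expR (- k * t)).

Let expE (a t : R) : is_derive t 1 (fun s => expR (a * s)) (expR (a * t) * a).
Proof.
have lin : is_derive t 1 (fun s : R => a * s) a.
  have := is_deriveZ a (is_derive_id t (1 : R)).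
  by rewrite /GRing.scale/= mulr1.
exact: is_derive1_comp.
Qed.

Let WE (t : R) : is_derive t 1 W (w t).
Proof.
have := is_deriveZ k^-1 (is_derive_subx (expE k t) (expE (- k) t)).
move=> /is_derive_congr; apply => //; rewrite /w /GRing.scale/=.
by have := lt0r_neq0 k0; move: k => c c0; field.
Qed.

Let W0 : W 0 = 0.
Proof. by rewrite /W !mulr0 subrr mulr0. Qed.

Let w1 (t : R) : 1 <= w t.
Proof.
have [t0|/ltW t0] := leP 0 t; [rewrite /w ler_wpDr ?expR_ge0//|
  rewrite /w ler_wpDl ?expR_ge0//]; rewrite -expR0 ler_expR.
  by rewrite mulr_ge0// ltW.
by rewrite mulNr -mulrN mulr_ge0 ?oppr_ge0// ltW.
Qed.

Let Ww (t : R) : n%:R * L * `|W t| <= w t / 2.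
Proof.
have e1 := expR_ge0 (k * t); have e2 := expR_ge0 (- k * t).
have : `|expR (k * t) - expR (- k * t)| <= w t by rewrite /w ler_norml; lra.
have k1 : 0 <= k^-1 by rewrite invr_ge0 ltW.
rewrite /W normrM (ger0_norm k1).
move: `|_ - _| (normr_ge0 (expR (k * t) - expR (- k * t))) => d d0 dw.
rewrite ler_pdivlMr//.
have -> : n%:R * L * (k^-1 * d) * 2 = (2 * n%:R * L / k) * d by field; exact: lt0r_neq0.
apply: le_trans dw; rewrite ler_piMl// ler_pdivrMr// mul1r /k lerDl.
exact: ler01.
Qed.

Let step_bound (d e : R -> 'rV[R]_n) (c : R) : 0 <= c ->
  (forall t, `|d t| <= c * w t) -> e 0 = 0 ->
  (forall t : R, is_derive t 1 e (d t *m B t)) ->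
  forall t, `|e t| <= c / 2 * w t.
Proof.
move=> c0 dw e0 eE t.
have GE (s : R) : is_derive s 1 (fun s => (c * (n%:R * L)) * W s)
    ((c * (n%:R * L)) * w s) by exact: is_deriveZ.
have := @derive_dominated_row _ _ e _ _ _ e0 _ eE GE _ t.
rewrite W0 mulr0 => /(_ erefl) H.
apply: le_trans (H _) _ => [s|].
  apply: le_trans (mulmx_norm_le _ _) _.
  rewrite [leRHS](_ : _ = n%:R * (c * w s * L)); last by ring.
  by rewrite ler_wpM2l// ler_pM.
rewrite normrM ger0_norm ?mulr_ge0// -mulrA.
have := ler_wpM2l c0 (Ww t); lra.
Qed.

(** Picard iteration. In the weight [w] it contracts by [1 / 2] on the whole
line, hence a global solution at once. *)
Theorem linear_ode_solution (u0 : 'rV[R]_n) : exists u : R -> 'rV[R]_n,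
  u 0 = u0 /\ forall t : R, is_derive t 1 u (u t *m B t).
Proof.
have /choice[prim primE] : forall f : R -> 'rV[R]_n, exists F : R -> 'rV[R]_n,
    continuous f -> F 0 = u0 /\ forall t : R, is_derive t 1 F (f t *m B t).
  move=> f; have [cf|ncf] := pselect (continuous f); last by exists f.
  have [|F [F0 FE]] := @antiderivative_row R n (fun t => f t *m B t).
    by move=> t; apply: continuous_mulmx; [exact: cf|exact: cB].
  exists (fun t => u0 + F t) => _; split; first by rewrite F0 addr0.
  move=> t; have := is_derive_addx (is_derive_cst u0 t (1 : R)) (FE t).
  by rewrite add0r.
pose s := fix s m := if m is m'.+1 then prim (s m') else fun=> u0.
have sc m : continuous (s m).
  elim: m => [|m IH] t; first exact: cst_continuous.
  by have [_ /(_ t)] := primE _ IH; exact: is_derive_continuous.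
have s0 m : s m 0 = u0.
  by case: m => [//|m]; have [] := primE _ (sc m).
have sE m (t : R) : is_derive t 1 (s m.+1) (s m t *m B t).
  by have [_] := primE _ (sc m); apply.
pose c := `|u0|; have c0 : 0 <= c by exact: normr_ge0.
have sw m t : `|s m.+1 t - s m t| <= c / 2 ^+ m * w t.
  elim: m t => [|m IH] t.
    apply: le_trans (_ : c / 2 * w t <= _); last first.
      rewrite expr0 ler_wpM2r//; last lra.
      exact: le_trans (w1 t).
    apply: (@step_bound (fun=> u0) (fun t => s 1%N t - s 0%N t)) => // [r||r].
    - by rewrite ler_peMr.
    - by rewrite !s0 subrr.
    - have := is_derive_subx (sE 0%N r) (is_derive_cst u0 r (1 : R)).
      by rewrite subr0.
  rewrite exprSr invfM mulrA.
  apply: (@step_bound (fun t => s m.+1 t - s m t)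
                      (fun t => s m.+2 t - s m.+1 t)) => // [||r].
  - by rewrite divr_ge0 ?exprn_ge0.
  - by rewrite !s0 subrr.
  - by rewrite mulmxBl; exact: is_derive_subx (sE m.+1 r) (sE m r).
have /choice[u uE] : forall t, exists l, forall m,
    `|l - s m t| <= 2 * (c * w t) / 2 ^+ m.
  move=> t; apply: (@telescoping_limit _ _ _ (fun m => s m t)) => m.
  by rewrite mulrAC.
have uc : continuous u.
  move=> t; apply/cvgrPdist_lt => e e0.
  have e3 : 0 < e / 3 by rewrite divr_gt0.
  have [m me] := exists_div_pow2_lt (2 * (c * (w t + 1))) e3.
  have wc : {for t, continuous w}.
    apply: (@is_derive_continuous _ _ _ _ _
      (is_derive_addx (expE k t) (expE (- k) t))).
  have um r : w r <= w t + 1 -> `|u r - s m r| < e / 3.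
    move=> wr; apply: le_lt_trans (uE r m) _; apply: le_lt_trans me.
    rewrite ler_wpM2r ?invr_ge0 ?exprn_ge0// ler_wpM2l// ler_wpM2l//.
  near=> r.
  have wr : w r <= w t + 1.
    have : `|w t - w r| < 1 by near: r; exact: (cvgrPdist_lt _ _).1 wc _ ltr01.
    by rewrite ltr_norml => /andP[]; lra.
  have sr : `|s m t - s m r| < e / 3.
    by near: r; exact: (cvgrPdist_lt _ _).1 (sc m t) _ e3.
  have -> : u t - u r = (u t - s m t) + (s m t - s m r) - (u r - s m r).
    by rewrite subrKA opprB addrA subrK.
  have wt : w t <= w t + 1 by rewrite lerDl.
  have := ler_normB ((u t - s m t) + (s m t - s m r)) (u r - s m r).
  have := ler_normD (u t - s m t) (s m t - s m r).
  have := um _ wt; have := um _ wr; lra.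
have [v0 vE] := primE _ uc.
suff uv t : prim u t = u t.
  have E : prim u = u by exact/funext.
  exists u; split=> [|t]; first by rewrite -E.
  by have := vE t; rewrite E.
apply/eqP; rewrite -subr_eq0 -normr_le0; apply/ler_addgt0Pl => e e0.
have [m me] := exists_div_pow2_lt (2 * (c * w t)) e0.
(* [prim u] and [s m.+1] are the Picard steps from [u] and [s m]. *)
have H : `|prim u t - s m.+1 t| <= 2 * c / 2 ^+ m / 2 * w t.
  apply: (@step_bound (fun t => u t - s m t)
                      (fun t => prim u t - s m.+1 t)) => [|r||r].
  - by rewrite divr_ge0 ?mulr_ge0 ?exprn_ge0.
  - by apply: le_trans (uE r m) _; rewrite mulrA mulrAC.
  - by rewrite v0 s0 subrr.
  - by rewrite mulmxBl; exact: is_derive_subx (vE r) (sE m r).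
have := uE t m.+1; have := ler_normB (prim u t - s m.+1 t) (u t - s m.+1 t).
rewrite opprB addrA subrK addr0 exprS invfM.
move: me H; move: (2 ^+ m)^-1 => q me H.
have -> : 2 * (c * w t) * (2^-1 * q) = c * w t * q by field.
have : 2 * c * q / 2 * w t = c * w t * q by field.
lra.
Unshelve. all: by end_near. Qed.

End LinearODE.

(** * Smooth functions on an open set *)

(** A remainder quadratic in [h] is what parallel transport provides, see
[transport_expansion]. *)
Lemma differentiable_of_quadratic (R : realType) (V W : normedModType R)
    (f : V -> W) (x : V) (df : {linear V -> W}) (C d : R) :
  continuous df -> 0 < d ->
  (forall h, `|h| <= d -> `|f (x + h) - f x - df h| <= C * `|h| ^+ 2) ->
  differentiable f x /\ 'd f x = df :> (V -> W).
Proof.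
move=> cdf d0 Hq.
have H : f \o shift x = cst (f x) + df +o_ (0 : V) id.
  apply/eqaddoP => e e0.
  pose C' := `|C| + 1; have C'0 : 0 < C' by rewrite ltr_wpDl.
  have d1 : 0 < Num.min d (e / C') by rewrite lt_min d0 divr_gt0.
  near=> h.
  have hd : `|h| <= Num.min d (e / C').
    by near: h; apply: nbhs0_le.
  move: hd; rewrite le_min => /andP[hd he].
  have -> : (f \o shift x - (cst (f x) + df)) h = f (x + h) - f x - df h.
    by rewrite !fctE /= /shift/= opprD addrA [h + x]addrC.
  apply: le_trans (Hq h hd) _.
  rewrite expr2 mulrA ler_wpM2r//.
  apply: (@le_trans _ _ (C' * `|h|)).
    by rewrite ler_wpM2r// /C' (le_trans (ler_norm _))// lerDl.
  by rewrite mulrC -ler_pdivlMr.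
have E := diff_unique cdf H.
split=> //; apply/diff_locallyP; rewrite E; split => //.
Unshelve. all: by end_near. Qed.

(** The difference [g - f] vanishes near [x], hence is differentiable at [x]. *)
Lemma near_eq_differentiable (R : realType) (V W : normedModType R)
    (f g : V -> W) (x : V) :
  {near x, f =1 g} -> differentiable f x -> differentiable g x.
Proof.
move=> fg fx; rewrite (_ : g = f + (g - f)); last by rewrite addrC subrK.
apply: differentiableD; first exact: fx.
have [d d0 H] : exists2 d : R, 0 < d & forall h, `|h| <= d -> g (x + h) = f (x + h).
  move: fg => /nbhs_normP[d /= d0 H]; exists (d / 2); first by rewrite divr_gt0.
  move=> h hd; apply/esym/H; rewrite /ball_/= opprD addNKr normrN.
  by apply: le_lt_trans hd _; rewrite ltr_pdivrMr// ltr_pMr// ltr1n.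
have [] // := @differentiable_of_quadratic _ _ _ (g - f) x
  (GRing.Linear.clone _ _ _ _ (\0 : V -> W) _) 0 d _ d0.
  exact: cst_continuous.
move=> h hd; rewrite !fctE H// subrr.
have := H 0; rewrite normr0 addr0 => ->; last exact: ltW.
by rewrite subrr !subr0 normr0 mul0r.
Qed.

Lemma near_eq_continuous (T W : topologicalType) (f g : T -> W) (x : T) :
  {near x, f =1 g} -> {for x, continuous f} -> {for x, continuous g}.
Proof.
move=> fg; rewrite /prop_for /continuous_at -(nbhs_singleton fg) => fx.
by apply: cvg_trans fx; exact: near_eq_cvg.
Qed.

Section Smoothness.
Variables (R : realType) (n : nat) (U : set 'rV[R]_n).
Hypothesis oU : open U.

Let Unbhs x : U x -> nbhs x U.
Proof. by move=> Ux; apply: open_nbhs_nbhs; split. Qed.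

Lemma Ck_on_continuous (W : normedModType R) k (f : 'rV[R]_n -> W) :
  Ck_on k U f -> forall x, U x -> {for x, continuous f}.
Proof.
by case: k => [//|k] [df _] x /df; exact: differentiable_continuous.
Qed.

Lemma Ck_on_pred (W : normedModType R) k (f : 'rV[R]_n -> W) :
  Ck_on k.+1 U f -> Ck_on k U f.
Proof.
elim: k f => [|k IH] f; first exact: Ck_on_continuous.
by move=> [df Df]; split => // v; apply: IH.
Qed.

(** Functions are total but only their values on [U] matter. Openness
makes this true: derivatives at a point of [U] only see [U]. *)
Lemma Ck_on_ext (W : normedModType R) k (f g : 'rV[R]_n -> W) :
  (forall x, U x -> f x = g x) -> Ck_on k U f -> Ck_on k U g.
Proof.
elim: k f g => [|k IH] f g fg.
  move=> cf x Ux; apply: near_eq_continuous (cf x Ux).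
  by near=> y; apply: fg; near: y; exact: Unbhs.
move=> [df Df]; split=> [x Ux|v].
  apply: near_eq_differentiable (df x Ux).
  by near=> y; apply: fg; near: y; exact: Unbhs.
apply: IH (Df v) => x Ux; apply: near_eq_derive.
by near=> y; apply: fg; near: y; exact: Unbhs.
Unshelve. all: by end_near. Qed.

Lemma Ck_on_cst (W : normedModType R) k (a : W) :
  Ck_on k U (fun _ : 'rV[R]_n => a).
Proof.
elim: k a => [|k IH] a; first by move=> x _; exact: cst_continuous.
split=> [x _|v]; first exact: differentiable_cst.
apply: (Ck_on_ext _ (IH 0)) => x _; exact/esym/derive_cst.
Qed.

Lemma Ck_on_add (W : normedModType R) k (f g : 'rV[R]_n -> W) :
  Ck_on k U f -> Ck_on k U g -> Ck_on k U (fun x => f x + g x).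
Proof.
elim: k f g => [|k IH] f g.
  by move=> cf cg x Ux; exact: continuousD (cf x Ux) (cg x Ux).
move=> [df Df] [dg Dg]; split=> [x Ux|v].
  by apply: differentiableD; [exact: df|exact: dg].
apply: Ck_on_ext (IH _ _ (Df v) (Dg v)) => x Ux.
rewrite (_ : (fun x0 => f x0 + g x0) = f + g)// deriveD//.
  by apply: diff_derivable; exact: df.
by apply: diff_derivable; exact: dg.
Qed.

Lemma Ck_on_mul k (f g : 'rV[R]_n -> R) :
  Ck_on k U f -> Ck_on k U g -> Ck_on k U (fun x => f x * g x).
Proof.
elim: k f g => [|k IH] f g.
  by move=> cf cg x Ux; exact: continuousM (cf x Ux) (cg x Ux).
move=> Cf Cg; have [df Df] := Cf; have [dg Dg] := Cg; split=> [x Ux|v].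
  by apply: differentiableM; [exact: df|exact: dg].
apply: Ck_on_ext (Ck_on_add (IH _ _ (Ck_on_pred Cf) (Dg v))
                            (IH _ _ (Ck_on_pred Cg) (Df v))) => x Ux.
by rewrite (_ : (fun x0 => f x0 * g x0) = f * g)// deriveM//;
  apply: diff_derivable; [exact: df|exact: dg].
Qed.

Lemma Ck_on_sum (W : normedModType R) k m (f : 'I_m -> 'rV[R]_n -> W) :
  (forall i, Ck_on k U (f i)) -> Ck_on k U (fun x => \sum_(i < m) f i x).
Proof.
elim: m f => [|m IH] f Cf.
  by apply: Ck_on_ext (Ck_on_cst k 0) => x _; rewrite big_ord0.
have C := Ck_on_add (IH _ (fun i => Cf (widen_ord (leqnSn m) i))) (Cf ord_max).
by apply: Ck_on_ext C => x _; rewrite big_ord_recr.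
Qed.

Lemma differentiable_mx p q (M : 'rV[R]_n -> 'M[R]_(p, q)) x :
  (forall i j, differentiable (fun y => M y i j) x) -> differentiable M x.
Proof.
move=> dM.
rewrite (_ : M = \sum_(i < p) \sum_(j < q) (fun y => M y i j *: delta_mx i j)).
  apply: differentiable_sum => i; apply: differentiable_sum => j.
  exact: differentiableZl.
apply/funext => y; rewrite fct_sumE {1}(matrix_sum_delta (M y)).
by apply: eq_bigr => i _; rewrite fct_sumE.
Qed.

Lemma Ck_on_mxP k p q (M : 'rV[R]_n -> 'M[R]_(p, q)) :
  Ck_on k U M <-> forall i j, Ck_on k U (fun x => M x i j).
Proof.
elim: k M => [|k IH] M.
  split=> [cM i j x Ux|cM x Ux]; last first.
    by apply: continuous_mx => i j; exact: (cM i j x Ux).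
  apply: (@continuous_comp _ _ _ M (fun Q => Q i j)); first exact: (cM x Ux).
  exact: coord_continuous.
split=> [[dM DM] i j|CM].
  split=> [x Ux|v].
    apply: (@differentiable_comp _ _ _ _ M (fun Q => Q i j)); first exact: dM.
    exact: differentiable_coord.
  have /IH/(_ i j) := DM v; apply: Ck_on_ext => x Ux.
  by rewrite derive_mx ?mxE//; apply: diff_derivable; exact: dM.
have dM x : U x -> differentiable M x.
  by move=> Ux; apply: differentiable_mx => i j; have [+ _] := CM i j; apply.
split=> // v; apply/IH => i j; have [_ /(_ v)] := CM i j.
apply: Ck_on_ext => x Ux.
by rewrite derive_mx ?mxE//; apply: diff_derivable; exact: dM.
Qed.

Lemma Ck_on_mulmx k p q s (M : 'rV[R]_n -> 'M[R]_(p, q))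
    (N : 'rV[R]_n -> 'M[R]_(q, s)) :
  Ck_on k U M -> Ck_on k U N -> Ck_on k U (fun x => M x *m N x).
Proof.
move=> /Ck_on_mxP CM /Ck_on_mxP CN; apply/Ck_on_mxP => i j.
apply: (@Ck_on_ext _ _ (fun x => \sum_(k < q) M x i k * N x k j)).
  by move=> x _; rewrite mxE.
by apply: Ck_on_sum => l; apply: Ck_on_mul.
Qed.

Lemma Ck_on_scalemx k p q (f : 'rV[R]_n -> R) (M : 'rV[R]_n -> 'M[R]_(p, q)) :
  Ck_on k U f -> Ck_on k U M -> Ck_on k U (fun x => f x *: M x).
Proof.
move=> Cf /Ck_on_mxP CM; apply/Ck_on_mxP => i j.
apply: (@Ck_on_ext _ _ (fun x => f x * M x i j)).
  by move=> x _; rewrite mxE.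
exact: Ck_on_mul.
Qed.

Lemma Ck_on_is_derive (W : normedModType R) k (f : 'rV[R]_n -> W) x v :
  Ck_on k.+1 U f -> U x -> is_derive x v f ('D_v f x).
Proof.
by move=> [df _] Ux; apply: DeriveDef => //; apply: diff_derivable; exact: df.
Qed.

Lemma derive_coord (W : normedModType R) (f : 'rV[R]_n -> W) x v :
  differentiable f x ->
  'D_v f x = \sum_(k < n) v 0 k *: 'D_(delta_mx 0 k) f x.
Proof.
move=> df; rewrite deriveE// {1}(row_sum_delta v) linear_sum.
by apply: eq_bigr => k _; rewrite linearZ deriveE.
Qed.

Lemma segment_MVT (f : 'rV[R]_n -> R) x v (s : R) : 0 <= s ->
  (forall t : R, 0 <= t <= s -> U (x + t *: v)) ->
  (forall y, U y -> differentiable f y) ->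
  exists2 t : R, 0 <= t <= s & f (x + s *: v) - f x = s * 'D_v f (x + t *: v).
Proof.
move=> s0 Us df.
have fE (t : R) : 0 <= t <= s ->
    is_derive t 1 (fun t => f (x + t *: v)) ('D_v f (x + t *: v)).
  move=> ts; apply: is_derive_line; apply: DeriveDef => //.
  by apply: diff_derivable; apply: df; exact: Us.
have [] := @MVT_segment R (fun t => f (x + t *: v))
  (fun t => 'D_v f (x + t *: v)) 0 s s0.
- by move=> t; rewrite in_itv/= => /andP[t0 ts]; apply: fE; rewrite !ltW.
- apply: derivable_within_continuous => t; rewrite in_itv/= => /fE[].
  by [].
- move=> t; rewrite in_itv/= => ts; rewrite scale0r addr0 subr0 => E.
  by exists t => //; rewrite E mulrC.
Qed.

(** Two applications of the mean value theorem, first along [v] to the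
difference of [f] along [w], then along [w] to the derivative along [v]. *)
Lemma mixed_difference (f : 'rV[R]_n -> R) x v w (s : R) : 0 <= s ->
  (forall a b : R, 0 <= a <= s -> 0 <= b <= s -> U (x + a *: v + b *: w)) ->
  Ck_on 2 U f ->
  exists a b : R, [/\ 0 <= a <= s, 0 <= b <= s &
    f (x + s *: v + s *: w) - f (x + s *: v) - f (x + s *: w) + f x =
    s ^+ 2 * 'D_w (fun y => 'D_v f y) (x + a *: v + b *: w)].
Proof.
move=> s0 Us Cf.
have [df Df] := Cf.
have s01 : 0 <= s <= s by rewrite s0 lexx.
have z01 : 0 <= (0 : R) <= s by rewrite s0 lexx.
pose F y := f (y + s *: w) - f y.
have FE (a : R) : 0 <= a <= s -> is_derive a 1 (fun a => F (x + a *: v))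
    ('D_v f (x + a *: v + s *: w) - 'D_v f (x + a *: v)).
  move=> aI; apply: is_derive_subx; last first.
    apply: is_derive_line; apply: (Ck_on_is_derive v Cf).
    by have := Us a 0 aI z01; rewrite scale0r addr0.
  have := @is_derive_line R _ _ f (x + s *: w) v a
    ('D_v f (x + a *: v + s *: w)).
  rewrite addrAC => H; have /H : is_derive (x + a *: v + s *: w) v f
      ('D_v f (x + a *: v + s *: w)).
    by apply: (Ck_on_is_derive v Cf); exact: Us.
  by move=> /is_derive_congr; apply => // b; rewrite addrAC.
have [] := @MVT_segment R (fun a => F (x + a *: v))
  (fun a => 'D_v f (x + a *: v + s *: w) - 'D_v f (x + a *: v)) 0 s s0.
- by move=> a; rewrite in_itv/= => /andP[a0 aS]; apply: FE; rewrite !ltW.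
- apply: derivable_within_continuous => a; rewrite in_itv/= => /FE[].
  by [].
move=> a; rewrite in_itv/= => aI.
have [df' _] := Df v.
have [b bI E1] := @segment_MVT (fun y => 'D_v f y) (x + a *: v) w s s0
  (fun b bI => Us a b aI bI) df'.
rewrite E1 scale0r addr0 subr0 /F => E2; exists a, b; split => //.
transitivity (s * 'D_w ('D_v f) (x + a *: v + b *: w) * s).
  by rewrite -E2; ring.
ring.
Qed.

(** The mixed second difference of [f] is symmetric in [v] and [w]; by
[mixed_difference] each of the two mixed derivatives takes the value of this
difference, divided by [s ^+ 2], at a point close to [x]. They are continuous,
so they agree at [x]. *)
Lemma derive_sym (f : 'rV[R]_n -> R) x v w : Ck_on 2 U f -> U x ->
  'D_w (fun y => 'D_v f y) x = 'D_v (fun y => 'D_w f y) x.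
Proof.
move=> Cf Ux.
pose g1 := 'D_w (fun y => 'D_v f y); pose g2 := 'D_v (fun y => 'D_w f y).
have c1 : {for x, continuous g1} by have [_ /(_ v)[_ /(_ w)]] := Cf; apply.
have c2 : {for x, continuous g2} by have [_ /(_ w)[_ /(_ v)]] := Cf; apply.
rewrite -/(g1 x) -/(g2 x); apply/eqP; rewrite -subr_eq0 -normr_le0.
apply/ler_addgt0Pl => e e0; rewrite addr0.
have tri (a b z : R) : `|a - z| < e / 2 -> `|b - z| < e / 2 -> `|a - b| <= e.
  move=> az bz; have -> : a - b = (a - z) - (b - z) by ring.
  by apply: le_trans (ler_normB _ _) _; lra.
have e2 : 0 < e / 2 by rewrite divr_gt0.
have n1 : \forall y \near x, `|g1 x - g1 y| < e / 2.
  exact: (cvgrPdist_lt _ _).1 c1 _ e2.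
have n2 : \forall y \near x, `|g2 x - g2 y| < e / 2.
  exact: (cvgrPdist_lt _ _).1 c2 _ e2.
have : \forall y \near x, U y /\ `|g1 x - g1 y| < e / 2
                            /\ `|g2 x - g2 y| < e / 2.
  exact: filterI (Unbhs Ux) (filterI n1 n2).
move=> /nbhs_normP[d /= d0 Hd].
pose L := `|v| + `|w| + 1.
have L0 : 0 < L by rewrite ltr_wpDl// addr_ge0.
pose s := d / 2 / L; have s0 : 0 < s by rewrite !divr_gt0.
have near_x a b : 0 <= a <= s -> 0 <= b <= s ->
    `|x - (x + a *: v + b *: w)| < d.
  move=> /andP[a0 aS] /andP[b0 bS].
  rewrite -addrA opprD addNKr normrN.
  apply: le_lt_trans (ler_normD _ _) _; rewrite !normrZ !ger0_norm//.
  apply: (@le_lt_trans _ _ (s * L)); last first.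
    by rewrite /s divfK ?gt_eqF// ltr_pdivrMr// ltr_pMr// ltr1n.
  have := ler_wpM2r (normr_ge0 v) aS; have := ler_wpM2r (normr_ge0 w) bS.
  by rewrite /L !mulrDr mulr1; lra.
have [|a [b [aI bI E1]]] := @mixed_difference f x v w s (ltW s0) _ Cf.
  by move=> a b aI bI; have [] := Hd _ (near_x _ _ aI bI).
have [|b' [a' [bI' aI' E2]]] := @mixed_difference f x w v s (ltW s0) _ Cf.
  move=> b' a' bI' aI'; rewrite addrAC.
  by have [] := Hd _ (near_x _ _ aI' bI').
have [_ [H1 _]] := Hd _ (near_x _ _ aI bI).
have [_ [_ H2]] := Hd _ (near_x _ _ aI' bI').
move: E2; rewrite [x + s *: w + _]addrAC [x + b' *: w + _]addrAC => E2.
have E : g1 (x + a *: v + b *: w) = g2 (x + a' *: v + b' *: w).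
  apply: (@mulfI _ (s ^+ 2)); first by rewrite expf_neq0// gt_eqF.
  apply: etrans (esym E1) _; apply: etrans E2; congr (_ + _).
  exact: addrAC.
rewrite E in H1.
exact: (tri (g1 x) (g2 x) _ H1 H2).
Qed.

Lemma lipschitz_of_derive_bound (f : 'rV[R]_n -> R) (K : set 'rV[R]_n) (M : R) :
  K `<=` U -> (forall x, U x -> differentiable f x) -> 0 <= M ->
  (forall y k, K y -> `|'D_(delta_mx 0 k) f y| <= M) ->
  forall y h, (forall t : R, 0 <= t <= 1 -> K (y + t *: h)) ->
    `|f (y + h) - f y| <= n%:R * M * `|h|.
Proof.
move=> KU df M0 fM y h Kyh.
have [t tI] := @segment_MVT f y h 1 ler01 (fun t tI => KU _ (Kyh t tI)) df.
rewrite scale1r mul1r => ->; rewrite derive_coord; last exact/df/KU/Kyh.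
apply: le_trans (ler_norm_sum _ _ _) _.
apply: (@le_trans _ _ (\sum_(k < n) `|h| * M)).
  apply: ler_sum => k _; rewrite normrM ler_pM// ?mx_entry_norm_le//.
  exact/fM/Kyh.
by rewrite sumr_const card_ord -[leLHS]mulr_natl mulrAC mulrA.
Qed.

(** The mean value theorem turns the remainder into a difference of first
derivatives, to which the Lipschitz bound applies. The constant depends on [K]
only: parallel transport needs the estimate uniformly along a ray. *)
Lemma taylor1_of_derive_bound (f : 'rV[R]_n -> R) (K : set 'rV[R]_n) (M : R) :
  K `<=` U -> Ck_on 2 U f -> 0 <= M ->
  (forall y k l, K y ->
     `|'D_(delta_mx 0 l) (fun z => 'D_(delta_mx 0 k) f z) y| <= M) ->
  forall y h, (forall t : R, 0 <= t <= 1 -> K (y + t *: h)) ->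
    `|f (y + h) - f y - 'D_h f y| <= n%:R ^+ 2 * M * `|h| ^+ 2.
Proof.
move=> KU [df Df] M0 fM y h Kyh.
have [t tI] := @segment_MVT f y h 1 ler01 (fun t tI => KU _ (Kyh t tI)) df.
have Ky : K y by have := Kyh 0; rewrite scale0r addr0 lexx ler01; apply.
rewrite scale1r mul1r => ->.
rewrite !derive_coord; [|exact/df/KU|exact/df/KU/Kyh].
rewrite -sumrB; apply: le_trans (ler_norm_sum _ _ _) _.
apply: (@le_trans _ _ (\sum_(k < n) `|h| * (n%:R * M * `|h|))); last first.
  rewrite sumr_const card_ord -[leLHS]mulr_natl le_eqVlt.
  by apply/orP; left; apply/eqP; ring.
apply: ler_sum => k _; rewrite -scalerBr normrM ler_pM// ?mx_entry_norm_le//.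
have [t0 t1] := andP tI.
have th : `|t *: h| <= `|h| by rewrite normrZ ger0_norm// ler_piMl.
apply: le_trans (ler_wpM2l _ th); last by rewrite mulr_ge0.
apply: (@lipschitz_of_derive_bound (fun z => 'D_(delta_mx 0 k) f z) K) => //.
- by have [] := Df (delta_mx 0 k).
- by move=> z l; exact: fM.
move=> r /andP[r0 r1]; rewrite scalerA; apply: Kyh.
by rewrite mulr_ge0//= mulr_ile1.
Qed.

End Smoothness.

Lemma compact_norm_bound (R : realType) (T : topologicalType)
    (W : normedModType R) (K : set T) (f : T -> W) :
  compact K -> (forall x, K x -> {for x, continuous f}) ->
  exists2 M, 0 <= M & forall x, K x -> `|f x| <= M.
Proof.
move=> cK cf.
have : bounded_set (f @` K).
  apply: compact_bounded; apply: continuous_compact => //.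
  apply: continuous_in_subspaceT => x; rewrite inE; exact: cf.
move=> [M [_ HM]]; exists (`|M| + 1); first by rewrite addr_ge0.
move=> x Kx; apply: (HM (`|M| + 1)); last by exists x.
by rewrite (le_lt_trans (ler_norm _))// ltrDl.
Qed.

(** The sum of the individual bounds is a common one. *)
Lemma finite_uniform_bound (R : realType) (I : finType) (P : I -> R -> Prop) :
  (forall i C C', C <= C' -> P i C -> P i C') ->
  (forall i, exists2 C, 0 <= C & P i C) ->
  exists2 C, 0 <= C & forall i, P i C.
Proof.
move=> Pm PC; have /choice[C CP] : forall i, exists C, 0 <= C /\ P i C.
  by move=> i; have [C C0 PiC] := PC i; exists C.
have C0 i : 0 <= C i by have [] := CP i.
exists (\sum_i C i); first exact: sumr_ge0.
move=> i; have [_] := CP i; apply: Pm; rewrite (bigD1 i)//= lerDl.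
exact: sumr_ge0.
Qed.

(** * Euclidean balls *)

Section Ball.
Variables (R : realType) (n : nat) (c : 'rV[R]_n).

(** The square of the distance is convex and continuous by elementary algebra,
with neither a square root nor a triangle inequality. *)
Definition sqdist (x : 'rV[R]_n) : R := \sum_(i < n) (x 0 i - c 0 i) ^+ 2.

Lemma sqdist_ge0 x : 0 <= sqdist x.
Proof. by apply: sumr_ge0 => i _; rewrite sqr_ge0. Qed.

Lemma sqdistc : sqdist c = 0.
Proof. by rewrite /sqdist big1// => i _; rewrite subrr expr0n. Qed.

Lemma euclidean_ballE (r : R) : 0 < r ->
  euclidean_ball c r = [set x | sqdist x < r ^+ 2].
Proof.
move=> r0; apply/funext => x; apply/propext.
rewrite /euclidean_ball /= -/(sqdist x).
by rewrite -{1}(gtr0_norm r0) -sqrtr_sqr ltr_sqrt ?exprn_gt0.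
Qed.

Lemma sqdist_continuous : continuous sqdist.
Proof.
move=> x; apply: continuous_sumx => i.
apply: (@continuous_comp _ _ _ (fun y : 'rV[R]_n => y 0 i - c 0 i)
  (fun z : R => z ^+ 2)); last exact: exprn_continuous.
apply: continuousB; first exact: coord_continuous.
exact: cst_continuous.
Qed.

Lemma open_euclidean_ball (r : R) : 0 < r -> open (euclidean_ball c r).
Proof.
move=> r0; rewrite euclidean_ballE//.
apply: (@open_comp _ _ sqdist [set z | z < r ^+ 2]); last exact: open_lt.
by move=> x _; exact: sqdist_continuous.
Qed.

Lemma sqdist_convex y h (t : R) : 0 <= t <= 1 ->
  sqdist (y + t *: h) <= (1 - t) * sqdist y + t * sqdist (y + h).
Proof.
move=> /andP[t0 t1]; rewrite /sqdist !mulr_sumr -big_split/=.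
apply: ler_sum => i _; rewrite !mxE.
set a := y 0 i; set b := h 0 i; set d := c 0 i.
have : 0 <= t * (1 - t) * b ^+ 2 by rewrite mulr_ge0 ?sqr_ge0// mulr_ge0// subr_ge0.
lra.
Qed.

Lemma compact_sqdist_le (s : R) : compact [set x | sqdist x <= s].
Proof.
apply: bounded_closed_compact; last first.
  apply: (@closed_comp _ _ sqdist [set z | z <= s]); last exact: closed_le.
  by move=> x _; exact: sqdist_continuous.
exists (`|c| + (s + 1)); split; first exact: num_real.
move=> M sM x /= xs; apply: le_trans (ltW sM).
have s0 : 0 <= s := le_trans (sqdist_ge0 x) xs.
rewrite -(subrK c x) addrC; apply: le_trans (ler_normD _ _) _; rewrite lerD2l.
apply: mx_norm_le => [|i j]; first by rewrite addr_ge0.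
have : (x 0 j - c 0 j) ^+ 2 <= s.
  apply: le_trans xs; rewrite /sqdist (bigD1 j)//= lerDl.
  by apply: sumr_ge0 => k _; rewrite sqr_ge0.
rewrite (ord1 i) !mxE; move: (x 0 j - c 0 j) => z zs.
have := sqr_ge0 (`|z| - 1); rewrite -real_normK ?num_real// in zs *; nra.
Qed.

End Ball.

(** * Parallel sections of a flat connection form *)

Section Transport.
Variables (R : realType) (n : nat) (c : 'rV[R]_n) (r : R).
Hypothesis r0 : 0 < r.
Variable G : 'I_n -> 'rV[R]_n -> 'M[R]_n.

Local Notation U := (euclidean_ball c r).
Local Notation e k := (delta_mx 0 k : 'rV[R]_n).

Hypothesis smoothG : forall k, smooth_on U (G k).

Let oU : open U := open_euclidean_ball r0.

(** The value on [h] of the connection form at [y]. Sections are rows, so the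
connection form acts on them from the right. *)
Definition conn_form (y h : 'rV[R]_n) : 'M[R]_n := \sum_(k < n) h 0 k *: G k y.

Lemma conn_formD y h h' : conn_form y (h + h') = conn_form y h + conn_form y h'.
Proof.
by rewrite /conn_form -big_split; apply: eq_bigr => k _; rewrite mxE scalerDl.
Qed.

Lemma conn_formZ y a h : conn_form y (a *: h) = a *: conn_form y h.
Proof.
by rewrite /conn_form scaler_sumr; apply: eq_bigr => k _; rewrite mxE scalerA.
Qed.

Lemma conn_form_is_derive x v h : U x ->
  is_derive x v (fun y => conn_form y h) (\sum_(k < n) h 0 k *: 'D_v (G k) x).
Proof.
move=> Ux; apply: is_derive_sumx => k; apply: is_deriveZ.
exact: (Ck_on_is_derive _ (smoothG k 1)).
Qed.

(** A compact ball around [c] contains the rays from [c] to all the points near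
[x]; bounds for [G] and its first two derivatives on this ball give one [M] for
all small [h] and all points of the rays. *)
Lemma ray_bounds x : U x -> exists d M : R, [/\ 0 < d, 0 <= M &
  forall h : 'rV[R]_n, `|h| <= d -> U (x + h) /\
  forall t : R, 0 <= t <= 1 -> let y := c + t *: (x - c) in
  [/\ U y, U (y + t *: h),
      forall k, `|G k (y + t *: h)| <= M,
      forall k, `|G k (y + t *: h) - G k y| <= M * `|h| &
      forall k, `|G k (y + t *: h) - G k y - 'D_(t *: h) (G k) y|
                <= M * `|h| ^+ 2]].
Proof.
move=> Ux.
have Uq z : U z <-> sqdist c z < r ^+ 2 by rewrite euclidean_ballE.
pose s := (sqdist c x + r ^+ 2) / 2.
have qx : sqdist c x < r ^+ 2 by exact/Uq.
have xs : sqdist c x < s by rewrite /s; lra.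
have sr : s < r ^+ 2 by rewrite /s; lra.
pose K := [set z | sqdist c z <= s].
have cK : compact K by exact: compact_sqdist_le.
have KU : K `<=` U by move=> z /= zs; apply/Uq; exact: le_lt_trans sr.
have Kconv y h : K y -> K (y + h) ->
    forall t : R, 0 <= t <= 1 -> K (y + t *: h).
  move=> /= Ky Kyh t tI; apply: le_trans (sqdist_convex c y h tI) _.
  case/andP: tI => t0; rewrite -subr_ge0 => t1.
  have := ler_wpM2l t1 Ky; have := ler_wpM2l t0 Kyh; lra.
have Kc : K c by rewrite /K/= sqdistc (le_trans (sqdist_ge0 c x))// ltW.
have [d d0 Kxh] : exists2 d : R, 0 < d & forall h, `|h| <= d -> K (x + h).
  have : \forall z \near x, sqdist c z < s.
    exact: (@sqdist_continuous R n c x [set z | z < s] (lt_nbhsl xs)).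
  move=> /nbhs_normP[d /= d0 H]; exists (d / 2); first by rewrite divr_gt0.
  move=> h hd; apply/ltW/H; rewrite /ball_/= opprD addNKr normrN.
  by apply: le_lt_trans hd _; rewrite ltr_pdivrMr// ltr_pMr// ltr1n.
have entry k i j m : Ck_on m U (fun y => G k y i j).
  by have /(Ck_on_mxP oU) := smoothG k m; apply.
have [M0 M0_ge0 GM0] : exists2 M, 0 <= M & forall k, forall z, K z -> `|G k z| <= M.
  apply: finite_uniform_bound => [k M M' MM' H z Kz|k].
    exact: le_trans (H z Kz) MM'.
  apply: compact_norm_bound => // z Kz.
  exact: (Ck_on_continuous (smoothG k 0)) (KU _ Kz).
have [M1 M1_ge0 GM1] : exists2 M, 0 <= M & forall p : 'I_n * 'I_n * 'I_n * 'I_n,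
    forall z, K z -> `|'D_(e p.2) (fun y => G p.1.1.1 y p.1.1.2 p.1.2) z| <= M.
  apply: finite_uniform_bound => [p M M' MM' H z Kz|p].
    exact: le_trans (H z Kz) MM'.
  apply: compact_norm_bound => // z Kz.
  have [_ /(_ (e p.2)) D] := entry p.1.1.1 p.1.1.2 p.1.2 1.
  exact: (D z (KU z Kz)).
have [M2 M2_ge0 GM2] : exists2 M, 0 <= M &
    forall p : 'I_n * 'I_n * 'I_n * 'I_n * 'I_n,
    forall z, K z -> `|'D_(e p.2) (fun y' => 'D_(e p.1.2)
       (fun y => G p.1.1.1.1 y p.1.1.1.2 p.1.1.2) y') z| <= M.
  apply: finite_uniform_bound => [p M M' MM' H z Kz|p].
    exact: le_trans (H z Kz) MM'.
  apply: compact_norm_bound => // z Kz.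
  have [_ /(_ (e p.1.2)) [_ /(_ (e p.2)) D]] :=
    entry p.1.1.1.1 p.1.1.1.2 p.1.1.2 2.
  exact: (D z (KU z Kz)).
pose M := M0 + n%:R * M1 + n%:R ^+ 2 * M2.
have nM1 : 0 <= n%:R * M1 by rewrite mulr_ge0.
have nM2 : 0 <= n%:R ^+ 2 * M2 by rewrite mulr_ge0 ?exprn_ge0.
exists d, M; split=> //; first by rewrite /M !addr_ge0.
move=> h hd; split; first exact/KU/Kxh.
move=> t tI y.
have Ky : K y.
  apply: Kconv => //; rewrite addrC subrK -(addr0 x); apply: Kxh.
  by rewrite normr0 ltW.
have Kyh : K (y + t *: h).
  rewrite /y -addrA -scalerDr; apply: Kconv => //.
  by rewrite addrA [c + _]addrC subrK; exact: Kxh.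
have th : `|t *: h| <= `|h|.
  by have [t0 t1] := andP tI; rewrite normrZ ger0_norm// ler_piMl.
have Kseg := Kconv _ _ Ky Kyh.
split; [exact: KU|exact: KU| | |] => k.
- by apply: le_trans (GM0 k _ Kyh) _; rewrite /M; lra.
- apply: mx_norm_le => [|i j]; first by rewrite mulr_ge0// /M !addr_ge0.
  have [dE _] := entry k i j 1.
  have := @lipschitz_of_derive_bound _ _ _ _ K M1 KU dE M1_ge0
    (fun z l => GM1 (k, i, j, l) z) y _ Kseg.
  rewrite !mxE => /le_trans; apply; rewrite ler_pM// /M; lra.
- apply: mx_norm_le => [|i j]; first by rewrite mulr_ge0 ?exprn_ge0// /M !addr_ge0.
  have := @taylor1_of_derive_bound _ _ _ _ K M2 KU (entry k i j 2) M2_ge0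
    (fun z l l' => GM2 (k, i, j, l, l') z) y _ Kseg.
  have dG : derivable (G k) y (t *: h).
    by have [] := Ck_on_is_derive (t *: h) (smoothG k 1) (KU _ Ky).
  rewrite !mxE derive_mx// mxE => /le_trans; apply.
  apply: ler_pM => //; first by rewrite /M; lra.
  by rewrite lerXn2r ?nnegrE.
Qed.

(** The derivative of [conn_form] in the base point, in the direction [v]; see
[conn_form_is_derive]. *)
Definition dconn_form (y v h : 'rV[R]_n) : 'M[R]_n :=
  \sum_(k < n) h 0 k *: 'D_v (G k) y.

Local Notation A := conn_form.
Local Notation dA := dconn_form.

Lemma ray_in_ball x (t : R) : U x -> 0 <= t <= 1 -> U (c + t *: (x - c)).
Proof.
move=> Ux tI; have [d [M [d0 M0 H]]] := ray_bounds Ux.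
have [|_ /(_ t tI)[]//] := H 0; by rewrite normr0 ltW.
Qed.

Lemma ray_conn_form_bound x : U x -> exists2 L, 0 <= L &
  forall t : R, 0 <= t <= 1 ->
    `|- A (c + t *: (x - c)) (x - c)| <= L.
Proof.
move=> Ux; have [d [M [d0 M0 H]]] := ray_bounds Ux.
exists (n%:R * (`|x - c| * M)); first by rewrite !mulr_ge0.
move=> t tI; rewrite normrN; apply: row_comb_norm_le => k.
have [|_ /(_ t tI)[_ _ /(_ k)]] := H 0; first by rewrite normr0 ltW.
by rewrite scaler0 addr0.
Qed.

(** Parallel transport along the ray from [c] to [x]. The coefficient makes sense
on the ray only; clamping the time to the unit interval extends it to a bounded
continuous function on the line. *)
Lemma ray_transport x (s0 : 'rV[R]_n) : U x ->
  exists u : R -> 'rV[R]_n, u 0 = s0 /\ forall t : R, 0 <= t <= 1 ->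
    is_derive t 1 u (u t *m - A (c + t *: (x - c)) (x - c)).
Proof.
move=> Ux; have [L L0 BL] := ray_conn_form_bound Ux.
pose clamp (t : R) := Num.max 0 (Num.min t 1).
have clampI t : 0 <= clamp t <= 1.
  by rewrite /clamp le_max lexx/= ge_max ler01/= ge_min lexx orbT.
have clampE t : 0 <= t <= 1 -> clamp t = t.
  by move=> /andP[t0 t1]; rewrite /clamp (min_idPl t1) (max_idPr t0).
have clampC : continuous clamp.
  move=> t.
  have c1 : {for t, continuous (fun s : R => Num.min s 1)}.
    exact: (@continuous_min _ _ (fun s : R => s) (fun=> 1) t
      (fun _ H => H) (@cst_continuous _ _ (1 : R) t)).
  exact: (@continuous_max _ _ (fun=> 0) _ t (@cst_continuous _ _ (0 : R) t) c1).
pose B0 t := - A (c + t *: (x - c)) (x - c).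
have B0C (t : R) : 0 <= t <= 1 -> {for t, continuous B0}.
  move=> tI; apply: is_derive_continuous; apply: is_derive_oppx.
  apply: (is_derive_line (f := fun y => conn_form y (x - c))).
  by apply: conn_form_is_derive; exact: ray_in_ball.
have [|u [u0 uE]] := @linear_ode_solution R n (B0 \o clamp) L _
    (fun t => BL _ (clampI t)) s0.
  by move=> t; apply: continuous_comp; [exact: clampC|exact: B0C].
by exists u; split=> // t tI; have := uE t; rewrite /= clampE.
Qed.

Hypothesis flatG : forall (k l : 'I_n) x, U x ->
  'D_(e k) (G l) x - 'D_(e l) (G k) x + G l x *m G k x - G k x *m G l x = 0.

Lemma flat_conn_form x v h : U x ->
  dA x v h - dA x h v
  + conn_form x h *m conn_form x v - conn_form x v *m conn_form x h = 0.
Proof.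
move=> Ux.
have dG k : differentiable (G k) x by have [+ _] := smoothG k 1; apply.
have -> : dA x v h =
    \sum_(l < n) \sum_(k < n) (h 0 l * v 0 k) *: 'D_(e k) (G l) x.
  apply: eq_bigr => l _; rewrite (derive_coord _ (dG l)) scaler_sumr.
  by apply: eq_bigr => k _; rewrite scalerA.
have -> : dA x h v =
    \sum_(l < n) \sum_(k < n) (h 0 l * v 0 k) *: 'D_(e l) (G k) x.
  rewrite exchange_big; apply: eq_bigr => k _.
  rewrite (derive_coord _ (dG k)) scaler_sumr.
  by apply: eq_bigr => l _; rewrite scalerA mulrC.
have mulE a b : conn_form x a *m conn_form x b =
    \sum_(l < n) \sum_(k < n) (a 0 l * b 0 k) *: (G l x *m G k x).
  rewrite /conn_form mulmx_suml; apply: eq_bigr => l _.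
  rewrite mulmx_sumr; apply: eq_bigr => k _.
  by rewrite -scalemxAl -scalemxAr scalerA.
rewrite !mulE [X in _ - X]exchange_big -!(sumrB, big_split)/=.
rewrite big1// => l _; rewrite -!(sumrB, big_split)/= big1// => k _.
by rewrite [v 0 k * _]mulrC -!(scalerBr, scalerDr) flatG// scaler0.
Qed.

(** The algebra of [transport_expansion]. There [a] and [b] are the values on
[v] and [h] of the connection form at a point of the ray to [x], [al] and [be]
those at the corresponding point of the ray to [x + h], and [d1], [d2] are the
derivatives of the form along [v] evaluated on [h] and along [h] evaluated on
[v]. The left-hand side is the derivative of the defect [w - u + t *: (u *m b)].
Flatness trades [d1] for [d2]; after that every term except the one that
contains the defect itself is of second order in [h]. *)
Lemma defect_equation (w u : 'rV[R]_n) (a b al be d1 d2 : 'M[R]_n) (t : R) :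
  d1 - d2 + b *m a - a *m b = 0 ->
  w *m - (al + be) - u *m - a
    + (u *m b + t *: (u *m - a *m b + u *m d1)) =
  (w - u + t *: (u *m b)) *m - (al + be)
  - u *m (al - a - t *: d2) - u *m (be - b)
  + t *: (u *m b *m (al + be - a)).
Proof.
move=> /eqP; rewrite subr_eq0 -addrA [X in _ + X]addrC addrA subr_eq => /eqP E.
have -> : d1 = a *m b + d2 - b *m a by rewrite -E addrK.
rewrite !(mulmxDl, mulmxDr, mulmxBl, mulmxBr, mulmxN, mulNmx, mulmxA, scalerDr,
  scalerBr, scalerN, opprD, opprK) -?scalemxAl -?scalemxAr.
move: (u *m b *m al) (u *m b *m be) (u *m b *m a) (u *m a *m b) => x1 x2 x3 x4.
move: (u *m d2) (u *m b) (u *m a) (u *m al) (u *m be) => x5 x6 x7 x8 x9.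
move: (w *m al) (w *m be) => x10 x11.
by apply/rowP => j; rewrite !mxE; ring.
Qed.

(** [P] is the value at time [1] of transport along rays. With [u] and [w] the
transports towards [x] and [x + h], the defect [g = w - u + t *: (u *m A h)]
vanishes at time [0] and satisfies [g' = g *m B + O(h^2)] by [defect_equation],
so that it is [O(h^2)] at time [1] by [gronwall]. The regularity of the
transport as a function of its end point comes from this estimate. *)
Lemma transport_expansion (P : 'rV[R]_n -> 'rV[R]_n) (s0 : 'rV[R]_n) :
  (forall x, U x -> exists u : R -> 'rV[R]_n, [/\ u 0 = s0, u 1 = P x &
    forall t : R, 0 <= t <= 1 ->
      is_derive t 1 u (u t *m - A (c + t *: (x - c)) (x - c))]) ->
  forall x, U x -> exists d C : R, 0 < d /\ forall h : 'rV[R]_n, `|h| <= d ->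
    `|P (x + h) - P x + P x *m A x h| <= C * `|h| ^+ 2.
Proof.
move=> PE x Ux; set v : 'rV[R]_n := x - c.
have [d [M [d0 M0 H]]] := ray_bounds Ux.
have [u [u0 u1 uE]] := PE _ Ux.
have [Mu Mu0 uM] : exists2 Mu : R, 0 <= Mu &
    forall t : R, t \in `[0, 1] -> `|u t| <= Mu.
  apply: compact_norm_bound; first exact: segment_compact.
  by move=> t /=; rewrite in_itv/= => /uE; exact: is_derive_continuous.
pose nn : R := n%:R.
(* [L] bounds what multiplies [g] in [defect_equation]; the summands of [E] bound
   the other three terms, in units of [`|h| ^+ 2]. *)
pose L := nn * (nn * ((`|v| + d) * M)).
pose E := nn * (Mu * (nn * (`|v| * M))) + nn * (Mu * (nn * M))
  + nn * (nn * (Mu * (nn * M)) * (nn * (`|v| * M) + nn * M)).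
exists d, (E * expR (nn * (2 * L + 1))); split=> // h hd.
have [Uxh Hh] := H h hd.
have [w [w0 w1 wE]] := PE _ Uxh.
have vh : x + h - c = v + h by rewrite /v addrAC.
pose y (t : R) := c + t *: v.
have yh (t : R) : c + t *: (x + h - c) = y t + t *: h.
  by rewrite vh scalerDr addrA.
pose g t := w t - u t + t *: (u t *m A (y t) h).
pose dg t := w t *m - A (y t + t *: h) (v + h) - u t *m - A (y t) v
  + (u t *m A (y t) h
     + t *: (u t *m - A (y t) v *m A (y t) h + u t *m dA (y t) v h)).
have gE (t : R) : 0 <= t <= 1 -> is_derive t 1 g (dg t).
  move=> tI; have [Uy _ _ _ _] := Hh t tI.
  apply: is_derive_addx.
    apply: is_derive_subx; last exact: uE.
    by have := wE t tI; rewrite yh vh.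
  have AE : is_derive t 1 (fun s => A (y s) h) (dA (y t) v h).
    apply: (is_derive_line (f := fun z => A z h)).
    exact: conn_form_is_derive.
  have := is_derive_scalemx (is_derive_id t (1 : R)) (is_derive_mulmx (uE t tI) AE).
  by rewrite scale1r.
have dg_le (t : R) : 0 <= t <= 1 -> `|dg t| <= L * `|g t| + E * `|h| ^+ 2.
  move=> tI; have [+ + GM Gh Gh2] := Hh t tI.
  rewrite -/v -/(y t) => Uy Uyh.
  have GyM k : `|G k (y t)| <= M.
    have [|_ /(_ t tI)[_ _ /(_ k)]] := H 0; first by rewrite normr0 ltW.
    by rewrite scaler0 addr0.
  have [t0 t1] := andP tI.
  rewrite /dg conn_formD (defect_equation _ _ _ _ _ (flat_conn_form v h Uy)).
  rewrite -/(g t).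
  have n1 : `|A (y t + t *: h) v + A (y t + t *: h) h| <= nn * ((`|v| + d) * M).
    rewrite -conn_formD; apply: le_trans (row_comb_norm_le _ GM) _.
    rewrite ler_wpM2l// ler_wpM2r//; apply: le_trans (ler_normD _ _) _.
    by rewrite lerD2l.
  have n2 : `|A (y t + t *: h) v - A (y t) v - t *: dA (y t) h v|
      <= nn * (`|v| * (M * `|h| ^+ 2)).
    rewrite (_ : _ - _ = \sum_(k < n) v 0 k *:
      (G k (y t + t *: h) - G k (y t) - 'D_(t *: h) (G k) (y t))).
      by apply: row_comb_norm_le => k; exact: Gh2.
    rewrite /conn_form /dconn_form scaler_sumr -!sumrB; apply: eq_bigr => k _.
    have dG : differentiable (G k) (y t) by have [+ _] := smoothG k 1; apply.
    have -> : 'D_(t *: h) (G k) (y t) = t *: 'D_h (G k) (y t).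
      by rewrite !deriveE// [LHS]linearZ.
    by rewrite !scalerBr !scalerA [t * _]mulrC.
  have n3 : `|A (y t + t *: h) h - A (y t) h| <= nn * (`|h| * (M * `|h|)).
    rewrite /conn_form -sumrB.
    rewrite (eq_bigr (fun k => h 0 k *: (G k (y t + t *: h) - G k (y t)))).
      exact: row_comb_norm_le.
    by move=> k _; rewrite scalerBr.
  have n4 : `|A (y t) h| <= nn * (`|h| * M) by exact: row_comb_norm_le.
  have n5 : `|A (y t + t *: h) v + A (y t + t *: h) h - A (y t) v|
      <= nn * (`|v| * (M * `|h|)) + nn * (`|h| * M).
    rewrite addrAC; apply: le_trans (ler_normD _ _) _; apply: lerD.
      rewrite /conn_form -sumrB.
      rewrite (eq_bigr (fun k => v 0 k *: (G k (y t + t *: h) - G k (y t)))).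
        exact: row_comb_norm_le.
      by move=> k _; rewrite scalerBr.
    exact: row_comb_norm_le.
  have mul_le p q (X : 'M[R]_(p, n)) (Y : 'M[R]_(n, q)) a b :
      `|X| <= a -> `|Y| <= b -> `|X *m Y| <= nn * (a * b).
    move=> Xa Yb; apply: le_trans (mulmx_norm_le _ _) _.
    by rewrite ler_wpM2l// ler_pM.
  have ut : `|u t| <= Mu by apply: uM; rewrite in_itv.
  have b1 := mul_le _ _ _ _ _ _ (lexx `|g t|) n1.
  have b2 := mul_le _ _ _ _ _ _ ut n2.
  have b3 := mul_le _ _ _ _ _ _ ut n3.
  have b4 := mul_le _ _ _ _ _ _ (mul_le _ _ _ _ _ _ ut n4) n5.
  rewrite mulmxN.
  apply: le_trans (ler_normD _ _) _; rewrite normrZ (ger0_norm t0).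
  apply: le_trans (lerD (ler_normB _ _) (ler_piMl _ t1)) _ => //.
  apply: le_trans (lerD (lerD (ler_normB _ _) b3) b4) _; rewrite normrN.
  apply: le_trans (lerD (lerD (lerD b1 b2) (lexx _)) (lexx _)) _.
  rewrite /L /E le_eqVlt; apply/orP; left; apply/eqP; ring.
have g0 : g 0 = 0 by rewrite /g w0 u0 subrr scale0r addr0.
have E0 : 0 <= E by rewrite /E !(addr_ge0, mulr_ge0).
have L0 : 0 <= L by rewrite /L !(addr_ge0, mulr_ge0)// ltW.
have Eh0 : 0 <= E * `|h| ^+ 2 by rewrite mulr_ge0 ?exprn_ge0.
have := gronwall L0 Eh0 g0 gE dg_le.
rewrite /g /y u1 w1 !scale1r mulrAC {1}/v.
by rewrite [c + _]addrC subrK.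
Qed.

Definition parallel (P : 'rV[R]_n -> 'rV[R]_n) : Prop :=
  forall x v, U x -> differentiable P x /\ 'D_v P x = - (P x *m A x v).

Lemma Ck_on_conn_form k v : Ck_on k U (fun x => A x v).
Proof.
by apply: Ck_on_sum => // l; apply: Ck_on_scalemx => //; [exact: Ck_on_cst|
  exact: smoothG].
Qed.

(** Bootstrap: the equation makes the derivative of [P] as regular as [P]. *)
Lemma parallel_smooth P : parallel P -> smooth_on U P.
Proof.
move=> Ppar; elim=> [|k IH].
  by move=> x /(Ppar x 0)[dP _]; exact: differentiable_continuous.
split=> [x /(Ppar x 0)[]//|v].
have C := Ck_on_mulmx oU IH (Ck_on_conn_form k v).
apply: Ck_on_ext (Ck_on_scalemx oU (Ck_on_cst oU k (-1 : R)) C) => // x Ux.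
by have [_ ->] := Ppar x v Ux; rewrite scaleN1r.
Qed.

(** Along the ray from [c] to [x], a parallel section solves a linear ordinary
differential equation. *)
Lemma parallel_vanish P x : parallel P -> U x -> P x = 0 -> P c = 0.
Proof.
move=> Ppar Ux Px; have [L L0 BL] := ray_conn_form_bound Ux.
have := @linear_ode_backward_uniqueness R n (fun t => P (c + t *: (x - c)))
  (fun t => - A (c + t *: (x - c)) (x - c)) L L0 _ BL.
rewrite scale0r addr0 scale1r [c + _]addrC subrK; apply=> // t tI.
apply: is_derive_line; rewrite mulmxN.
have [dP <-] := Ppar _ (x - c) (ray_in_ball Ux tI).
by apply: DeriveDef => //; exact: diff_derivable.
Qed.

Lemma conn_form_continuous x : continuous (A x).
Proof.
move=> h; rewrite (_ : A x = \sum_(k < n) (fun h : 'rV[R]_n => h 0 k *: G k x)).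
  apply: differentiable_continuous; apply: differentiable_sum => k.
  by apply: differentiableZl; exact: differentiable_coord.
by apply/funext => h'; rewrite fct_sumE.
Qed.

(** The section is the transport of [s0] from [c] along rays. *)
Theorem parallel_section_exists (s0 : 'rV[R]_n) :
  exists P : 'rV[R]_n -> 'rV[R]_n, parallel P /\ P c = s0.
Proof.
have /choice[P PE] : forall x, exists p : 'rV[R]_n, U x ->
    exists u : R -> 'rV[R]_n, [/\ u 0 = s0, u 1 = p &
    forall t : R, 0 <= t <= 1 ->
      is_derive t 1 u (u t *m - A (c + t *: (x - c)) (x - c))].
  move=> x; have [Ux|nUx] := pselect (U x); last by exists 0.
  have [u [u0 uE]] := ray_transport s0 Ux.
  by exists (u 1) => _; exists u.
exists P; split=> [x v Ux|].
  have [d [C [d0 PC]]] := transport_expansion PE Ux.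
  pose df (h : 'rV[R]_n) := - (P x *m A x h).
  have df_lin : linear df.
    move=> a h h'; rewrite /df conn_formD conn_formZ mulmxDr -scalemxAr.
    by rewrite opprD scalerN.
  pose dfM := GRing.isLinear.Build _ _ _ _ _ df_lin.
  pose dfL : {linear 'rV[R]_n -> 'rV[R]_n} := HB.pack df dfM.
  have dfC : continuous dfL.
    move=> h; have C1 : {for h, continuous (fun h' => P x *m A x h')}.
      apply: continuous_mulmx; first exact: cst_continuous.
      exact: conn_form_continuous.
    exact: continuousN C1.
  have [|dP PE'] := @differentiable_of_quadratic _ _ _ P x dfL C d dfC d0.
    by move=> h /PC; rewrite /= /df opprK.
  by split=> //; rewrite deriveE// PE'.
have Uc : U c by rewrite euclidean_ballE//= sqdistc exprn_gt0.
have [u [u0 <- uE]] := PE c Uc.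
apply/eqP; rewrite -subr_eq0 -normr_le0.
have := @gronwall R n (fun t => u t - s0) (fun=> 0) 0 0.
rewrite mul0r; apply=> // [|t /uE|t _]; first by rewrite u0 subrr.
  have -> : A (c + t *: (c - c)) (c - c) = 0.
    by rewrite subrr /conn_form big1// => k _; rewrite mxE scale0r.
  rewrite oppr0 mulmx0 => ut.
  by have := is_derive_subx ut (is_derive_cst s0 t (1 : R)); rewrite subr0.
by rewrite normr0 mul0r addr0.
Qed.

End Transport.

(** * The curvature of a connection in canonical coordinates *)

Section ConnectionFormula.
Variables (R : realType) (n : nat) (U : set 'rV[R]_n).
Hypothesis oU : open U.
Variable D : ('rV[R]_n -> 'rV[R]_n) -> ('rV[R]_n -> 'rV[R]_n) ->
  'rV[R]_n -> 'rV[R]_n.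
Hypothesis hD : linear_connection U D.
Implicit Types X Y Z : 'rV[R]_n -> 'rV[R]_n.

Local Notation e k := (delta_mx 0 k : 'rV[R]_n).
Local Notation VF := (vector_field U).

Definition christoffel (k : 'I_n) (x : 'rV[R]_n) : 'M[R]_n :=
  \matrix_(j < n) D (fun=> e k) (fun=> e j) x.

Local Notation A := (conn_form christoffel).
Local Notation dA := (dconn_form christoffel).

Let VF_cst v : VF (fun=> v). Proof. by move=> k; exact: Ck_on_cst. Qed.

Let VF_coord X i : VF X -> smooth_on U (fun x => X x 0 i).
Proof. by move=> sX k; have /(Ck_on_mxP oU) := sX k; apply. Qed.

Let VF_scale (f : 'rV[R]_n -> R) X :
  smooth_on U f -> VF X -> VF (fun x => f x *: X x).
Proof. by move=> sf sX k; exact: Ck_on_scalemx. Qed.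

Lemma christoffel_smooth k : smooth_on U (christoffel k).
Proof.
move=> m; apply/(Ck_on_mxP oU) => j i.
have /(Ck_on_mxP oU)/(_ 0 i) :=
  connection_vector_field hD (VF_cst (e k)) (VF_cst (e j)) m.
by apply: Ck_on_ext => // x _; rewrite mxE.
Qed.

Let scale00 : (fun _ : 'rV[R]_n => (0 : R) *: (0 : 'rV[R]_n)) = (fun=> 0).
Proof. by apply/funext => y; rewrite scaler0. Qed.

Lemma connection0r X x : VF X -> U x -> D X (fun=> 0) x = 0.
Proof.
move=> sX Ux.
have := connection_leibniz hD (fun k => Ck_on_cst oU k (0 : R)) sX (VF_cst 0) Ux.
by rewrite scale00 derive_cst !scale0r addr0.
Qed.

Lemma connection0l Y x : VF Y -> U x -> D (fun=> 0) Y x = 0.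
Proof.
move=> sY Ux.
have := connectionZl hD (fun k => Ck_on_cst oU k (0 : R)) (VF_cst 0) sY Ux.
by rewrite scale00 scale0r.
Qed.

Lemma connection_sumr m X (Y : 'I_m -> 'rV[R]_n -> 'rV[R]_n) x :
  VF X -> (forall i, VF (Y i)) -> U x ->
  D X (fun y => \sum_(i < m) Y i y) x = \sum_(i < m) D X (Y i) x.
Proof.
move=> sX + Ux; elim: m Y => [|m IH] Y sY.
  rewrite big_ord0 -[RHS](connection0r sX Ux); congr (D _ _ _).
  by apply/funext => y; rewrite big_ord0.
rewrite big_ord_recr/= -IH//.
rewrite -(connectionDr hD) //; last by move=> k; apply: Ck_on_sum => // i; exact: sY.
by congr (D _ _ _); apply/funext => y; rewrite big_ord_recr.
Qed.

Lemma connection_suml m (X : 'I_m -> 'rV[R]_n -> 'rV[R]_n) Y x :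
  VF Y -> (forall i, VF (X i)) -> U x ->
  D (fun y => \sum_(i < m) X i y) Y x = \sum_(i < m) D (X i) Y x.
Proof.
move=> sY + Ux; elim: m X => [|m IH] X sX.
  rewrite big_ord0 -[RHS](connection0l sY Ux); congr (D _ _ _).
  by apply/funext => y; rewrite big_ord0.
rewrite big_ord_recr/= -IH//.
rewrite -(connectionDl hD) //; last by move=> k; apply: Ck_on_sum => // i; exact: sX.
by congr (D _ _ _); apply/funext => y; rewrite big_ord_recr.
Qed.

(** Both fields are expanded in the canonical frame, whose coefficients are
smooth: this is linearity on one side and the Leibniz rule on the other. *)
Lemma connectionE X Y x : VF X -> VF Y -> U x ->
  D X Y x = 'D_(X x) Y x + Y x *m A x (X x).
Proof.
move=> sX sY Ux.
have Xe : X = fun y => \sum_(k < n) X y 0 k *: e k.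
  by apply/funext => y; rewrite -row_sum_delta.
have Ye : Y = fun y => \sum_(j < n) Y y 0 j *: e j.
  by apply/funext => y; rewrite -row_sum_delta.
have De j : D X (fun=> e j) x = row j (A x (X x)).
  rewrite [in LHS]Xe connection_suml//; last first.
    by move=> k; exact: (VF_scale (VF_coord k sX) (VF_cst (e k))).
  rewrite /conn_form raddf_sum; apply: eq_bigr => k _ /=.
  rewrite (connectionZl hD (VF_coord k sX) (VF_cst (e k)) (VF_cst (e j)) Ux).
  by rewrite linearZ/= rowK.
rewrite [in LHS]Ye connection_sumr//; last first.
  by move=> j; exact: (VF_scale (VF_coord j sY) (VF_cst (e j))).
rewrite mulmx_sum_row derive_mx; last first.
  by have [] := Ck_on_is_derive (X x) (sY 1) Ux.
rewrite [X in _ = X + _]row_sum_delta -big_split; apply: eq_bigr => j _ /=.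
rewrite (connection_leibniz hD (VF_coord j sY) sX (VF_cst (e j)) Ux) De.
by rewrite mxE.
Qed.

(** The direction [w] is expanded in coordinates because in this form the
Hessian comes out of differentiating [y |-> 'D_(Y y) Z y]. *)
Definition hessian Z (x v w : 'rV[R]_n) : 'rV[R]_n :=
  \sum_(k < n) w 0 k *: 'D_v (fun y => 'D_(e k) Z y) x.

Lemma derive_sym_row Z x v w : VF Z -> U x ->
  'D_w (fun y => 'D_v Z y) x = 'D_v (fun y => 'D_w Z y) x.
Proof.
move=> sZ Ux.
have CZ j : Ck_on 2 U (fun y => Z y 0 j).
  by have /(Ck_on_mxP oU) := sZ 2; apply.
have dZ a : Ck_on 1 U (fun y => 'D_a Z y) by have [_] := sZ 2; apply.
have DE j a b : 'D_b (fun y => 'D_a Z y) x 0 j =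
    'D_b (fun y => 'D_a (fun z => Z z 0 j) y) x.
  have /is_derive_mxP/(_ 0 j) H1 := Ck_on_is_derive b (dZ a) Ux.
  rewrite -(@derive_val _ _ _ _ _ _ _ H1); apply: near_eq_derive.
  near=> y; have Uy : U y by near: y; apply: open_nbhs_nbhs; split.
  have /is_derive_mxP/(_ 0 j) H2 := Ck_on_is_derive a (sZ 1) Uy.
  by rewrite (@derive_val _ _ _ _ _ _ _ H2).
apply/rowP => j; apply: etrans (DE j v w) _; apply: etrans _ (esym (DE j w v)).
exact: (derive_sym oU _ _ (CZ j) Ux).
Unshelve. all: by end_near. Qed.

Lemma hessian_sym Z x v w : VF Z -> U x -> hessian Z x v w = hessian Z x w v.
Proof.
move=> sZ Ux.
have dZ k : Ck_on 1 U (fun y => 'D_(e k) Z y) by have [_] := sZ 2; apply.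
have hessE a b : hessian Z x a b =
    \sum_(k < n) \sum_(l < n)
       (b 0 k * a 0 l) *: 'D_(e l) (fun y => 'D_(e k) Z y) x.
  apply: eq_bigr => k _; have [dk _] := dZ k.
  rewrite (derive_coord _ (dk x Ux)) scaler_sumr.
  by apply: eq_bigr => l _; rewrite scalerA.
rewrite !hessE [RHS]exchange_big; apply: eq_bigr => k _; apply: eq_bigr => l _.
exact: (congr2 (fun a y => a *: y) (mulrC _ _)
  (derive_sym_row (e k) (e l) sZ Ux)).
Qed.

Lemma derive_along_field Y Z x v : VF Y -> VF Z -> U x ->
  is_derive x v (fun y => 'D_(Y y) Z y)
    ('D_('D_v Y x) Z x + hessian Z x v (Y x)).
Proof.
move=> sY sZ Ux.
have dZ y : U y -> differentiable Z y by have [+ _] := sZ 1; apply.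
apply: (@near_eq_is_derive _ _ _
    (fun y => \sum_(k < n) Y y 0 k *: 'D_(e k) Z y)).
  near=> y; rewrite -derive_coord//; apply: dZ; near: y.
  by apply: open_nbhs_nbhs; split.
rewrite (derive_coord _ (dZ x Ux)) /hessian -big_split/=.
apply: is_derive_sumx => k; apply: is_derive_scalemx.
  have := Ck_on_is_derive v (sY 1) Ux; move=> /is_derive_mxP; exact.
have DZ : Ck_on 1 U (fun y => 'D_(e k) Z y) by have [_] := sZ 2; apply.
exact: (Ck_on_is_derive v DZ Ux).
Unshelve. all: by end_near. Qed.

Lemma derive_along_smooth Y Z : VF Y -> VF Z -> VF (fun y => 'D_(Y y) Z y).
Proof.
move=> sY sZ k.
apply: (@Ck_on_ext _ _ _ oU _ _ (fun y => \sum_(k < n) Y y 0 k *: 'D_(e k) Z y)).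
  by move=> y Uy; rewrite -derive_coord//; have [+ _] := sZ 1; apply.
apply: Ck_on_sum => // i; apply: Ck_on_scalemx => //; first exact: VF_coord.
by have [_] := sZ k.+1; apply.
Qed.

Lemma lie_bracket_smooth X Y : VF X -> VF Y -> VF (lie_bracket X Y).
Proof.
move=> sX sY k; have C := Ck_on_scalemx oU (Ck_on_cst oU k (-1 : R))
  (derive_along_smooth sY sX k).
apply: Ck_on_ext (Ck_on_add oU (derive_along_smooth sX sY k) C) => // y _.
by rewrite scaleN1r.
Qed.

Lemma conn_form_along_field Y x v : VF Y -> U x ->
  is_derive x v (fun y => A y (Y y)) (A x ('D_v Y x) + dA x v (Y x)).
Proof.
move=> sY Ux; rewrite /conn_form /dconn_form -big_split/=.
apply: is_derive_sumx => k; apply: is_derive_scalemx.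
  have := Ck_on_is_derive v (sY 1) Ux; move=> /is_derive_mxP; exact.
exact: (Ck_on_is_derive v (christoffel_smooth k 1) Ux).
Qed.

(** The terms are grouped by their fate in the curvature: the first group is
cancelled by the Lie bracket, the second is symmetric in [X] and [Y], and the
third is all that remains. *)
Lemma connection2E X Y Z x : VF X -> VF Y -> VF Z -> U x ->
  D X (D Y Z) x =
  ('D_('D_(X x) Y x) Z x + Z x *m A x ('D_(X x) Y x))
  + (hessian Z x (X x) (Y x)
     + ('D_(X x) Z x *m A x (Y x) + 'D_(Y x) Z x *m A x (X x)))
  + Z x *m (dA x (X x) (Y x) + A x (Y x) *m A x (X x)).
Proof.
move=> sX sY sZ Ux.
rewrite (connectionE sX (connection_vector_field hD sY sZ) Ux).
have W : is_derive x (X x) (D Y Z)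
    ('D_('D_(X x) Y x) Z x + hessian Z x (X x) (Y x)
     + ('D_(X x) Z x *m A x (Y x)
        + Z x *m (A x ('D_(X x) Y x) + dA x (X x) (Y x)))).
  apply: (@near_eq_is_derive _ _ _
      (fun y => 'D_(Y y) Z y + Z y *m A y (Y y))).
    near=> y; rewrite connectionE//; near: y.
    by apply: open_nbhs_nbhs; split.
  apply: is_derive_addx; first exact: derive_along_field.
  apply: is_derive_mulmx; last exact: conn_form_along_field.
  exact: (Ck_on_is_derive (X x) (sZ 1) Ux).
rewrite (@derive_val _ _ _ _ _ _ _ W) (connectionE sY sZ Ux).
have regroup (a b p q s t o : 'rV[R]_n) :
    a + b + (p + (q + s)) + (t + o) = a + q + (b + (p + t)) + (s + o).
  by apply/rowP => j; rewrite !mxE; ring.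
rewrite [Z x *m (A x _ + _)]mulmxDr [Z x *m (dA x _ _ + _)]mulmxDr.
rewrite [_ *m A x (X x)]mulmxDl mulmxA; exact: regroup.
Unshelve. all: by end_near. Qed.

(** The curvature form of the connection form. It acts on rows from the right,
which reverses the usual order of the products. *)
Definition conn_curvature (x v w : 'rV[R]_n) : 'M[R]_n :=
  dA x v w - dA x w v + A x w *m A x v - A x v *m A x w.

(** Curvature is a tensor: its value at [x] only depends on the values of the
three fields at [x]. *)
Lemma curvatureE X Y Z x : VF X -> VF Y -> VF Z -> U x ->
  curvature D X Y Z x = Z x *m conn_curvature x (X x) (Y x).
Proof.
move=> sX sY sZ Ux.
have sL := lie_bracket_smooth sX sY.
rewrite /curvature (connection2E sX sY sZ Ux) (connection2E sY sX sZ Ux).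
rewrite (connectionE sL sZ Ux) /lie_bracket.
have dZ : differentiable Z x by have [+ _] := sZ 1; apply.
have deriveB a b : 'D_(a - b) Z x = 'D_a Z x - 'D_b Z x.
  by rewrite !deriveE// linearB.
have conn_formB a b : A x (a - b) = A x a - A x b.
  by rewrite conn_formD -scaleN1r conn_formZ scaleN1r.
rewrite deriveB conn_formB.
rewrite (hessian_sym (Y x) (X x) sZ Ux) mulmxBr.
have cancel_sym (a b a' b' h s s' o o' : 'rV[R]_n) :
    a + b + (h + (s + s')) + o - (a' + b' + (h + (s' + s)) + o')
    - (a - a' + (b - b')) = o - o'.
  by apply/rowP => j; rewrite !mxE; ring.
apply: etrans (cancel_sym _ _ _ _ _ _ _ _ _) _.
rewrite -mulmxBr; congr (_ *m _).
by rewrite /conn_curvature opprD addrACA addrA.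
Qed.

End ConnectionFormula.

(** * Parallel frames *)

Lemma sum_delta_row (R : nzRingType) (n : nat) (V : lmodType R) (k : 'I_n)
    (F : 'I_n -> V) :
  \sum_(l < n) (delta_mx 0 k : 'rV[R]_n) 0 l *: F l = F k.
Proof.
rewrite (bigD1 k)//= mxE !eqxx scale1r big1 ?addr0// => l lk.
by rewrite mxE (negPf lk) andbF scale0r.
Qed.

Lemma basis_mulmx_eq0 (R : fieldType) (n m : nat) (b : n.-tuple 'rV[R]_n)
    (M : 'M[R]_(n, m)) :
  basis_of {:'rV[R]_n} b -> (forall i : 'I_n, b`_i *m M = 0) -> M = 0.
Proof.
move=> bb bM; apply/row_matrixP => i; rewrite row0 rowE.
rewrite (coord_basis bb (memvf (delta_mx 0 i))) mulmx_suml big1// => j _.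
by rewrite -scalemxAl bM scaler0.
Qed.

Lemma basis_of_rV (R : fieldType) (n : nat) (b : n.-tuple 'rV[R]_n) :
  (forall a : 'rV[R]_n, \sum_(i < n) a 0 i *: b`_i = 0 -> a = 0) ->
  basis_of {:'rV[R]_n} b.
Proof.
move=> ind; rewrite basisEfree subvf size_tuple dimvf /dim/= mul1n leqnn !andbT.
apply/freeP => k k0 i.
have /rowP/(_ i) : \row_j k j = 0.
  by apply: ind; rewrite -[RHS]k0; apply: eq_bigr => j _; rewrite mxE.
by rewrite !mxE.
Qed.

Section Main.
Variables (R : realType) (n : nat) (c : 'rV[R]_n) (r : R).
Hypothesis r0 : 0 < r.
Variable D : ('rV[R]_n -> 'rV[R]_n) -> ('rV[R]_n -> 'rV[R]_n) ->
  'rV[R]_n -> 'rV[R]_n.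
Local Notation U := (euclidean_ball c r).
Hypothesis hD : linear_connection U D.
Let oU : open U := open_euclidean_ball r0.
Local Notation e k := (delta_mx 0 k : 'rV[R]_n).
Local Notation G := (christoffel D).

Let VF_cst v : vector_field U (fun=> v). Proof. by move=> k; exact: Ck_on_cst. Qed.

(** The curvature form kills each field of the frame, because all the second
covariant derivatives of a parallel field vanish; at each point these fields form
a basis, so the curvature form is zero. *)
Lemma flat_of_parallel_frame (E : 'I_n -> 'rV[R]_n -> 'rV[R]_n) :
  frame U E ->
  (forall X j x, vector_field U X -> U x -> D X (E j) x = 0) ->
  flat U D.
Proof.
move=> [sE bE] DE X Y Z sX sY sZ x Ux.
rewrite (curvatureE oU hD)//.
rewrite (basis_mulmx_eq0 (M := conn_curvature D x (X x) (Y x)) (bE x Ux)) ?mulmx0//.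
move=> j; rewrite nth_mktuple -(curvatureE oU hD)//.
have D0 A B : vector_field U A -> vector_field U B -> D A (D B (E j)) x = 0.
  move=> sA sB; rewrite -[RHS](connection0r oU hD sA Ux).
  apply: (connection_ext hD) => //; last by rewrite inE.
  - exact: (connection_vector_field hD).
  - by move=> y; rewrite inE => Uy; rewrite DE.
rewrite /curvature !D0// subrr sub0r DE ?oppr0//.
exact: lie_bracket_smooth.
Qed.

Lemma flat_christoffel : flat U D -> forall (k l : 'I_n) x, U x ->
  'D_(e k) (G l) x - 'D_(e l) (G k) x + G l x *m G k x - G k x *m G l x = 0.
Proof.
move=> flatD k l x Ux; apply/row_matrixP => j; rewrite row0 rowE.
have := curvatureE oU hD (VF_cst (e k)) (VF_cst (e l)) (VF_cst (e j)) Ux.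
rewrite (flatD _ _ _ (VF_cst (e k)) (VF_cst (e l)) (VF_cst (e j)) x Ux).
have AE m : conn_form G x (e m) = G m x.
  exact: (sum_delta_row m (fun p => G p x)).
have dAE v m : dconn_form G x v (e m) = 'D_v (G m) x.
  exact: (sum_delta_row m (fun p => 'D_v (G p) x)).
by rewrite /conn_curvature !AE !dAE => /esym.
Qed.

(** The frame is obtained from the canonical basis at [c]. A linear relation
between its values at [x] says that some parallel section vanishes at [x], hence
at [c], where the relation must be trivial. *)
Lemma parallel_frame_of_flat : flat U D ->
  exists E : 'I_n -> 'rV[R]_n -> 'rV[R]_n, frame U E /\
    forall X j x, vector_field U X -> U x -> D X (E j) x = 0.
Proof.
move=> flatD; have sG := christoffel_smooth oU hD.
have flatG := flat_christoffel flatD.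
have /choice[E EP] := fun j : 'I_n => parallel_section_exists r0 sG flatG (e j).
have sE j : smooth_on U (E j) by have [+ _] := EP j; exact: parallel_smooth.
exists E; split; last first.
  move=> X j x sX Ux; rewrite (connectionE oU hD sX (sE j) Ux).
  by have [/(_ x (X x) Ux)[_ ->] _] := EP j; rewrite addNr.
split; first exact: sE.
move=> x Ux; apply: basis_of_rV => a.
under eq_bigr do rewrite nth_mktuple.
pose P y := \sum_(i < n) a 0 i *: E i y.
move=> Px.
have Ppar : parallel c r G P.
  move=> y v Uy.
  have PE : is_derive y v P (\sum_(i < n) a 0 i *: - (E i y *m conn_form G y v)).
    apply: is_derive_sumx => i; apply: is_deriveZ.
    have [/(_ y v Uy)[dE <-] _] := EP i.
    by apply: DeriveDef => //; exact: diff_derivable.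
  split.
    rewrite (_ : P = \sum_(i < n) (fun y => a 0 i *: E i y)).
      apply: differentiable_sum => i; apply: differentiableZ.
      by have [/(_ y v Uy)[]] := EP i.
    by apply/funext => z; rewrite fct_sumE.
  rewrite (@derive_val _ _ _ _ _ _ _ PE) mulmx_suml -sumrN.
  by apply: eq_bigr => i _; rewrite scalerN scalemxAl.
have := parallel_vanish r0 sG Ppar Ux Px.
rewrite /P (eq_bigr (fun i => a 0 i *: e i)); last by move=> i _; have [_ ->] := EP i.
by rewrite -row_sum_delta.
Qed.

End Main.

Unset Implicit Arguments.

Theorem corollary5 (R : realType) (n : nat) (c : 'rV[R]_n) (r : R)
    (hr : 0 < r)
    (D : ('rV[R]_n -> 'rV[R]_n) -> ('rV[R]_n -> 'rV[R]_n) ->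
         'rV[R]_n -> 'rV[R]_n)
    (hD : linear_connection (euclidean_ball c r) D) :
  (exists E : 'I_n -> 'rV[R]_n -> 'rV[R]_n,
     frame (euclidean_ball c r) E /\
     exists Gamma : 'I_n -> 'I_n -> 'I_n -> 'rV[R]_n -> R,
       connection_components (euclidean_ball c r) D E Gamma /\
       forall i j k x, euclidean_ball c r x -> Gamma i j k x = 0)
  <-> flat (euclidean_ball c r) D.
Proof.
split=> [[E [frE [Gamma [GammaE Gamma0]]]]|flatD].
  apply: (flat_of_parallel_frame hr hD frE) => X j x sX Ux.
  have [_ bE] := frE.
  rewrite (GammaE X (fun k y => coord [tuple E i y | i < n] k (X y)) sX _ j x Ux).
    by rewrite big1// => i _; rewrite big1// => k _; rewrite Gamma0// mul0r scale0r.
  move=> y Uy; rewrite [LHS](coord_basis (bE y Uy) (memvf _)).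
  by apply: eq_bigr => k _; rewrite nth_mktuple.
have [E [frE DE]] := parallel_frame_of_flat hr hD flatD.
exists E; split=> //; exists (fun _ _ _ _ => 0); split=> // X a sX _ j x Ux.
rewrite DE// big1// => i _; rewrite big1// => k _.
by rewrite mul0r scale0r.
Qed.
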